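(* Let $\eta\in\{2,3,4,\ldots\}$. Let $X=X_{\eta,0}$ be a set consisting of distinct points $x_0$ and $x_{i,j}$ ($i\in\{1,\ldots,\eta\}$, $j\in\mathbb N$), and let $\phi=\phi_{\eta,0}\colon X\to X$ be given by $\phi(x_0)=x_0$, $\phi(x_{i,1})=x_0$ for $i\in\{1,\ldots,\eta\}$, and $\phi(x_{i,j})=x_{i,j-1}$ for $i\in\{1,\ldots,\eta\}$ and $j\ge 2$. Then there exists a discrete measure $\mu$ on $X$ such that the composition operator $C_\phi$ in $L^2(\mu)$ has the following properties: (i) $C_\phi$ is injective and generates Stieltjes moment sequences, (ii) $C_\phi$ is not hyponormal, (iii) $\{\mathsf h_{\phi^n}(x)\}_{n=0}^\infty$ is a Stieltjes moment sequence for every $x\in X$, (iv) $\{\mathsf h_{\phi^n}(x_0)\}_{n=0}^\infty$ is H-determinate with index of H-determinacy at $0$ equal to $0$, (v) for all $i\in J_{\eta-1}$ and $j\in\mathbb N$, the sequence $\{\mathsf h_{\phi^n}(x_{i,j})\}_{n=0}^\infty$ is H-determinate with infinite index of H-determinacy, (vi) for every $j\in J_{2\eta-4}$, the sequence $\{\mathsf h_{\phi^n}(x_{\eta,j})\}_{n=0}^\infty$ is H-determinate and its unique H-representing measure $P(x_{\eta,j},\cdot)$ satisfies $$\eta-2-\lceil j/2\rceil\le \mathrm{ind}_0(P(x_{\eta,j},\cdot))\le \eta-2-\lfloor j/2\rfloor .$$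
   Context: Notation: $\mathbb N=\{1,2,\ldots\}$, $\mathbb Z_+=\{0,1,2,\ldots\}$, $\mathbb R_+=[0,\infty)$, $J_k=\{i\in\mathbb N: i\le k\}$ (so $J_0=\emptyset$); $0^0=1$. All measures are positive. Moments. Let $\mathscr M$ be the set of Borel measures $\nu$ on $\mathbb R$ with $\int_{\mathbb R}|t|^n\,d\nu(t)<\infty$ for all $n\in\mathbb Z_+$, and $\mathscr M^+$ the set of those $\nu\in\mathscr M$ with closed support contained in $\mathbb R_+$. A real sequence $\{\gamma_n\}_{n=0}^\infty$ is a Hamburger (resp. Stieltjes) moment sequence if there is $\nu\in\mathscr M$ (resp. $\nu\in\mathscr M^+$) with $\gamma_n=\int_{\mathbb R}t^n\,d\nu(t)$ for all $n\in\mathbb Z_+$; such $\nu$ are called its H-representing (resp. S-representing) measures. A Hamburger moment sequence is H-determinate if it has exactly one H-representing measure; a measure in $\mathscr M$ is H-determinate if its moment sequence is. The index of H-determinacy of an H-determinate measure $\rho$ at $z\in\mathbb C$ is $\mathrm{ind}_z(\rho)=\sup\{k\in\mathbb Z_+: |t-z|^{2k}d\rho(t)\text{ is H-determinate}\}\in\mathbb Z_+\cup\{\infty\}$. The index of an H-determinate moment sequence at $z$ is that of its unique H-representing measure; it has infinite index of H-determinacy if its index is $\infty$ at some (equivalently, every) $z\in\mathbb C$. Operators. A discrete measure on a nonempty set $X$ is a $\sigma$-finite measure $\mu$ on $2^X$ with $\mu(x):=\mu(\{x\})>0$ for all $x\in X$ (so $\mu(x)<\infty$ as well). For $\phi\colon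 X\to X$, the composition operator $C_\phi$ in $L^2(\mu)$ has domain $\{f\in L^2(\mu): f\circ\phi\in L^2(\mu)\}$ and $C_\phi f=f\circ\phi$. For $n\in\mathbb Z_+$, $\mathsf h_{\phi^n}(x)=\mu((\phi^n)^{-1}(\{x\}))/\mu(x)\in[0,\infty]$. For an operator $A$ in a Hilbert space $\mathcal H$ with domain $\mathcal D(A)$, $\mathcal D^\infty(A)=\bigcap_{n\ge0}\mathcal D(A^n)$. $A$ generates Stieltjes moment sequences if $\mathcal D^\infty(A)$ is dense in $\mathcal H$ and $\{\|A^nf\|^2\}_{n=0}^\infty$ is a Stieltjes moment sequence for every $f\in\mathcal D^\infty(A)$. $A$ is hyponormal if it is densely defined, $\mathcal D(A)\subseteq\mathcal D(A^* )$ and $\|A^*f\|\le\|Af\|$ for all $f\in\mathcal D(A)$. *)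

(* Defs.v *)
From HB Require Import structures.
From mathcomp Require Import all_boot all_order all_algebra.
From mathcomp Require Import all_classical all_reals all_analysis.
From mathcomp Require Import measurable_realfun.
From mathcomp Require Export complex.

Set Implicit Arguments.
Unset Strict Implicit.
Unset Printing Implicit Defensive.

Import Order.TTheory GRing.Theory Num.Theory.
Import numFieldTopology.Exports numFieldNormedType.Exports.

Local Open Scope classical_set_scope.
Local Open Scope ring_scope.
Local Open Scope ereal_scope.

Notation borel_measure R := {measure set (measurableTypeR R) -> \bar R%type}.

Section weighted.
Context {R : realType}.
Implicit Types (z : R[i]) (k : nat) (nu : borel_measure R).

Definition weight z k (t : R) : R := (Normc.normc (Complex t 0 - z) ^+ (2 * k))%R.

Lemma weight_ge0 z k t : (0 <= weight z k t)%R.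
Proof. by rewrite /weight exprM exprn_ge0// sqr_ge0. Qed.

Lemma measurable_weight z k :
  measurable_fun setT (fun t : measurableTypeR R => (weight z k t)%:E).
Proof.
apply/measurable_EFinP.
apply: (eq_measurable_fun (fun t : measurableTypeR R =>
    (((t : R) - complex.Re z) ^+ 2 + (complex.Im z) ^+ 2) ^+ k)%R); last first.
  apply: measurable_funX; apply: measurable_funD => //.
  by apply: measurable_funX; exact: measurable_funB.
move=> t _; rewrite /weight exprM; congr (_ ^+ _)%R.
by case: z => a b /=; rewrite sqr_sqrtr ?addr_ge0 ?sqr_ge0// sub0r sqrrN.
Qed.

(* The measure |t - z|^(2k) dnu(t). *)
Definition weighted nu z k (A : set (measurableTypeR R)) : \bar R :=
  \int[nu]_(t in A) (weight z k t)%:E.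

Section measure.
Variables (nu : borel_measure R) (z : R[i]) (k : nat).
Local Notation w := (weighted nu z k).

Let w0 : w set0 = 0. Proof. by rewrite /weighted integral_set0. Qed.

Let w_ge0 A : 0 <= w A.
Proof. by apply: integral_ge0 => t _; rewrite lee_fin weight_ge0. Qed.

Let w_sigma_additive : semi_sigma_additive w.
Proof.
apply: semi_sigma_additive_nng_induced; first exact: measurable_weight.
by move=> t; rewrite lee_fin weight_ge0.
Qed.

HB.instance Definition _ := isMeasure.Build _ _ _ w w0 w_ge0 w_sigma_additive.
End measure.

End weighted.

Section moments.
Context {R : realType}.
Implicit Types (nu rho : borel_measure R) (gamma : (\bar R)^nat) (z : R[i]).

Definition has_moments nu :=
  forall n : nat, \int[nu]_t (`|t| ^+ n)%:E < +oo.

Definition moment nu (n : nat) : \bar R := \int[nu]_t (t ^+ n)%:E.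

Definition closed_support nu : set R :=
  [set t | forall U : set R, open U -> U t -> 0 < nu U].

(* Sequences take values in [\bar R] because [h_iter] below does; a sequence
   with a representing measure is real valued, as all moments of a measure
   satisfying [has_moments] are finite. *)
Definition H_representing nu gamma :=
  has_moments nu /\ forall n, gamma n = moment nu n.

Definition S_representing nu gamma :=
  H_representing nu gamma /\ closed_support nu `<=` [set t | 0 <= t]%R.

Definition stieltjes_moment_sequence gamma :=
  exists nu, S_representing nu gamma.

(* Inhabitants of [borel_measure R] are total on [set R] and only meaningful on
   Borel sets, so uniqueness means agreement on the latter. *)
Definition H_determinate gamma :=
  exists2 nu, H_representing nu gamma &
    forall rho, H_representing rho gamma ->
      forall A : set (measurableTypeR R), measurable A -> rho A = nu A.

Definition H_determinate_measure nu :=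
  has_moments nu /\ H_determinate (moment nu).

Definition ind z rho : \bar R :=
  ereal_sup [set (k%:R)%:E | k in
    [set k : nat | H_determinate_measure (weighted rho z k)]].

Definition H_determinate_with_index gamma z (v : \bar R) :=
  H_determinate gamma /\ forall rho, H_representing rho gamma -> ind z rho = v.

Definition H_determinate_infinite_index gamma :=
  exists z, H_determinate_with_index gamma z +oo.

End moments.

Section operators.
Context d (X : measurableType d) (R : realType) (mu : {measure set X -> \bar R}).
Local Notation C := R[i].
Implicit Types (f g h : X -> C).

Definition discrete_measure :=
  [/\ forall A : set X, measurable A, sigma_finite setT mu &
      forall x : X, 0 < mu [set x]].

Local Notation sqint f := (\int[mu]_x ((Normc.normc (f x)) ^+ 2)%:E).

(* L^2(mu) for a discrete measure: every function is measurable and every point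
   has positive mass, so that classes modulo mu are plain functions. *)
Definition L2 : set (X -> C) := [set f | sqint f < +oo].

Definition L2norm f : R := Num.sqrt (fine (sqint f)).

Definition L2inner f g : C :=
  Complex (\int[mu]_x complex.Re (f x * conjc (g x)))%R
          (\int[mu]_x complex.Im (f x * conjc (g x)))%R.

Definition L2dense (D : set (X -> C)) :=
  forall f, L2 f -> forall e : R, (0 < e)%R ->
    exists2 g, D g & (L2norm (fun x => f x - g x) < e)%R.

(* An operator in L^2(mu); [app] is only meaningful on [dom].  Linearity is not
   bundled: the notions below do not depend on it. *)
Record operator := Operator {
  dom : set (X -> C) ;
  app : (X -> C) -> (X -> C) ;
  dom_L2 : dom `<=` L2 ;
  app_L2 : forall f, dom f -> L2 (app f) }.

Implicit Types A : operator.

Fixpoint dom_pow A (n : nat) : set (X -> C) :=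
  if n is m.+1 then [set f | dom_pow A m f /\ dom A (iter m (app A) f)] else L2.

Definition dom_infty A : set (X -> C) := \bigcap_n dom_pow A n.

Definition op_injective A :=
  forall f g, dom A f -> dom A g -> app A f = app A g -> f = g.

Definition generates_stieltjes A :=
  L2dense (dom_infty A) /\
  forall f, dom_infty A f ->
    stieltjes_moment_sequence (fun n => (L2norm (iter n (app A) f) ^+ 2)%:E).

(* (g, h) is in the graph of A^*. *)
Definition adjoint_graph A g h :=
  [/\ L2 g, L2 h & forall f, dom A f -> L2inner (app A f) g = L2inner f h].

Definition dom_adjoint A : set (X -> C) := [set g | exists h, adjoint_graph A g h].

Definition hyponormal A :=
  [/\ L2dense (dom A), dom A `<=` dom_adjoint A &
      forall f h, dom A f -> adjoint_graph A f h ->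
        (L2norm h <= L2norm (app A f))%R].

Variable phi : X -> X.

Definition composition_operator : operator :=
  @Operator [set f | L2 f /\ L2 (f \o phi)] (fun f => f \o phi)
    (fun f => @proj1 _ _) (fun f => @proj2 _ _).

Definition h_iter (n : nat) (x : X) : \bar R :=
  mu (iter n phi @^-1` [set x]) / mu [set x].

End operators.

(* Main.v *)
Require Import Defs.
From mathcomp Require Import all_boot all_order all_algebra.
From mathcomp Require Import all_classical all_reals all_analysis.
From mathcomp Require Import measurable_realfun ring lra zify.

Set Implicit Arguments.
Unset Strict Implicit.
Unset Printing Implicit Defensive.

Import Order.TTheory GRing.Theory Num.Theory.
Import numFieldTopology.Exports numFieldNormedType.Exports.

Local Open Scope classical_set_scope.
Local Open Scope ring_scope.
Local Open Scope ereal_scope.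

(** Let $b = 8$, $d_m = \prod_{l=1}^m (b^l - 1)$, and spread the masses
    $b^m / d_m$ over the points $b^m$.  Splitting $b^m = (b^m - 1) + 1$ shows
    that the half of this measure carried by the even powers and the half
    carried by the odd powers have the same moments ([even_odd_sum]); so the
    even half $\varepsilon$ and the odd half $o$ represent one indeterminate
    moment sequence.

    The measure $\mu$ is read off from $A\varepsilon$, the constant $A$ being
    fixed below: $\mu(x_0) = 1$, and $\mu(x_{i,j})$ is the moment of order
    $j-1$ of the $i$-th piece of $A\varepsilon$, where each of the first
    $\eta-1$ branches receives one atom, at $1, b^2, b^4, \ldots$ in turn, and
    the last branch receives what is left.  At the vertices of the branches the
    sequences $h_{\phi^n}$ are then moment sequences by construction.  At
    $x_0$, the increments of $h_{\phi^n}(x_0)$ are the moments of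
    $A\varepsilon$, hence also those of $A o$.  As $o$ lives above 1, the
    measure $A\,(t-1)^{-1} o(dt)$ is positive and has the same increments of
    moments; $A$ is chosen to give it mass 1, and it then represents
    $h_{\phi^n}(x_0)$.  Since $\|C_\phi^n f\|^2$ is the sum of
    $|f(x)|^2 \mu(x) h_{\phi^n}(x)$ over $x$, mixing the representing measures
    yields one for it ([generates_stieltjes_of_fibers]).

    The two halves being different measures, subnormality is not forced, and
    even hyponormality fails: for the indicator $e$ of $x_{1,1}$ one has
    $\|C_\phi e\|^2 = A$ and $\|C_\phi^* e\|^2 = A^2$, while $A \ge 2$
    because $b$ is large ([hyponormal_fiber]).

    For the indices, consider masses $a_k$ at points $\theta b^{2k+1}$ and
    compare them with the critical masses $g_k = b^{2k+1}/d_{2k+1}$ of $o$.  If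
    $a_k \ge \kappa g_k$, part of the mass can be exchanged for a multiple of
    a dilated copy of $\varepsilon$, and the measure is indeterminate
    ([critical_indeterminate]).  If $a_k \le C g_k / b^{2k}$, it is determinate
    ([critical_determinate]).  The measures at $x_0$ and on the last branch have
    masses comparable with $g_k b^{2sk}$ for some integer $s$, and
    multiplication by $t$ increases $s$ by 1; so these two cases leave no gap
    and determine the index.  The other branches carry point masses.

    Determinacy comes from an elementary argument ([lacunary_determinate]).
    The partial products $p_n$ of $\prod_k (1 - t/x_k)$ satisfy
    $\int p_n^2 \to 0$ for the given measure, hence for every measure with the
    same moments, whereas $p_n(t)$ stays away from 0 when $t$ is not one of the
    $x_k$; so any such measure lives on the $x_k$.  Leaving out one factor
    bounds the mass at one $x_k$ by $a_k$, and the total masses agree. *)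

(** * Measures carried by a sequence of atoms *)

Section atoms.
Context d (T : measurableType d) (R : realType).
Implicit Types (x : nat -> T) (a : nat -> R).

(** The absolute value only serves to accept real weights; the lemmas below
    assume them nonnegative. *)
Definition atoms x a : {measure set T -> \bar R} :=
  mseries (fun k => mscale (`|a k|%:nng)%R (dirac (x k))) 0.

Lemma integral_atoms x a (D : set T) (f : T -> \bar R) :
  measurable D -> (forall k, 0 <= a k)%R -> (forall t, 0 <= f t) ->
  measurable_fun D f ->
  \int[atoms x a]_(t in D) f t =
  \sum_(k <oo) ((a k)%:E * (\d_(x k) D * f (x k))).
Proof.
move=> mD a0 f0 mf; rewrite ge0_integral_measure_series//.
apply: eq_eseriesr => k _; rewrite ge0_integral_mscale//= integral_dirac//.
by rewrite ger0_norm.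
Qed.

Lemma integralT_atoms x a (f : T -> \bar R) :
  (forall k, 0 <= a k)%R -> (forall t, 0 <= f t) -> measurable_fun setT f ->
  \int[atoms x a]_t f t = \sum_(k <oo) ((a k)%:E * f (x k)).
Proof.
move=> a0 f0 mf; rewrite integral_atoms//.
by apply: eq_eseriesr => k _; rewrite diracT mul1e.
Qed.

Lemma atomsE x a (A : set T) : measurable A -> (forall k, 0 <= a k)%R ->
  atoms x a A = \sum_(k <oo) ((a k)%:E * \d_(x k) A).
Proof.
move=> mA a0; apply: eq_eseriesr => k _ /=.
by rewrite /mscale/= ger0_norm.
Qed.

Lemma atoms0 x a (A : set T) : measurable A -> (forall k, 0 <= a k)%R ->
  (forall k, a k != 0%R -> ~ A (x k)) -> atoms x a A = 0.
Proof.
move=> mA a0 h; rewrite atomsE// eseries0// => k _ _.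
have [->|/h nA] := eqVneq (a k) 0%R; first by rewrite mul0e.
by rewrite diracE memNset// mule0.
Qed.

Lemma atoms_set1 x a k : injective x -> measurable [set x k] ->
  (forall k, 0 <= a k)%R -> atoms x a [set x k] = (a k)%:E.
Proof.
move=> xI mx a0; rewrite atomsE// (@nneseriesD1 _ _ k)//; last first.
  by move=> i _; rewrite mule_ge0// lee_fin.
rewrite diracE mem_set// mule1 eseries0 ?adde0// => i _ /andP[_ ik].
by rewrite diracE memNset ?mule0// => /xI; exact/eqP.
Qed.

End atoms.

Section eseries_lemmas.
Context {R : realType}.
Implicit Types u : nat -> \bar R.

Lemma nneseries_recl0 u : (forall k, 0 <= u k) ->
  \sum_(k <oo) u k = u 0%N + \sum_(k <oo) u k.+1.
Proof.
move=> u0; rewrite nneseries_recl//; congr (_ + _).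
rewrite -(nneseries_addn 1)//; apply: eq_eseriesr => i _; by rewrite addn1.
Qed.

Lemma nneseries_half (C : R) : (0 <= C)%R ->
  \sum_(k <oo) (C / 2 ^+ k)%:E = (2 * C)%:E.
Proof.
move=> C0; have /cvg_lim := @cvg_geometric_eseries_half R (2 * C)%R 0.
rewrite expr0 divr1 => <-//; apply: eq_eseriesr => k _; congr EFin.
by rewrite addn1 natrX exprS; field; rewrite expf_neq0.
Qed.

Lemma nneseries_fin_half u (C : R) : (0 <= C)%R -> (forall k, 0 <= u k) ->
  (forall k, u k <= (C / 2 ^+ k)%:E) -> \sum_(k <oo) u k <= (2 * C)%:E.
Proof.
by move=> C0 u0 uC; rewrite -nneseries_half//; apply: lee_nneseries.
Qed.

Lemma nneseries_tail_small u (e : R) : (forall k, 0 <= u k) ->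
  \sum_(k <oo) u k < +oo -> (0 < e)%R ->
  exists N, forall n, (N <= n)%N -> \sum_(n <= k <oo) u k <= e%:E.
Proof.
move=> u0 usum e0; have /fine_cvgP[ffin fcvg] := nneseries_tail_cvg usum (fun k _ => u0 k).
have : \forall n \near \oo, \sum_(n <= k <oo) u k <= e%:E.
  near=> n.
  have nfin : \sum_(n <= k <oo) u k \is a fin_num by near: n.
  rewrite -(fineK nfin) lee_fin; apply: le_trans (ler_norm _) _.
  by near: n; move/cvgr0Pnorm_le : fcvg; exact.
by case=> N _ h; exists N => n /h.
Unshelve. all: by end_near. Qed.

End eseries_lemmas.

(** * Moments *)

Section moments.
Context {R : realType}.
Implicit Types (nu rho : borel_measure R) (x a : nat -> R).
Local Notation neg := (`]-oo, 0%R[%classic : set (measurableTypeR R)).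

Lemma measurable_abs_expr n :
  measurable_fun setT (fun t : measurableTypeR R => (`|t : R| ^+ n)%:E).
Proof.
by apply/measurable_EFinP; apply: measurable_funX.
Qed.

Lemma measurable_expr n :
  measurable_fun setT (fun t : measurableTypeR R => ((t : R) ^+ n)%:E).
Proof. by apply/measurable_EFinP; apply: measurable_funX. Qed.

Lemma closed_support_ge0 nu : nu neg = 0 ->
  closed_support nu `<=` [set t | 0 <= t]%R.
Proof.
move=> n0 t /= st; rewrite leNgt; apply/negP => t0.
have : 0 < nu neg by apply: st; [exact: interval_open | rewrite /= in_itv/=].
by rewrite n0 ltxx.
Qed.

(** Trading $t^n$ for $|t|^n$ makes the theorems on integrals of nonnegative
    functions available. *)
Lemma moment_abs nu n : nu neg = 0 ->
  moment nu n = \int[nu]_t (`|t| ^+ n)%:E.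
Proof.
move=> n0; rewrite /moment.
apply: ae_eq_integral => //.
- exact: measurable_expr.
- exact: measurable_abs_expr.
exists neg; split => // t /=; rewrite in_itv/= => /existsNP[_].
apply: contra_notP => /negP; rewrite -leNgt => t0.
by rewrite ger0_norm.
Qed.

Lemma atoms_neg x a : (forall k, 0 <= x k)%R -> (forall k, 0 <= a k)%R ->
  atoms (x : nat -> measurableTypeR R) a neg = 0.
Proof.
move=> x0 a0; apply: atoms0 => // k _; rewrite /= in_itv/= => xk.
by have := lt_le_trans xk (x0 k); rewrite ltxx.
Qed.

Lemma moment_atoms x a n : (forall k, 0 <= x k)%R -> (forall k, 0 <= a k)%R ->
  moment (atoms (x : nat -> measurableTypeR R) a) n =
  \sum_(k <oo) (a k * x k ^+ n)%:E.
Proof.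
move=> x0 a0; rewrite moment_abs ?atoms_neg// integralT_atoms//; last exact: measurable_abs_expr.
by apply: eq_eseriesr => k _; rewrite ger0_norm// EFinM.
Qed.

Lemma has_moments_neg nu : nu neg = 0 ->
  (forall n, moment nu n < +oo) -> has_moments nu.
Proof. by move=> n0 h n; rewrite -moment_abs. Qed.

Lemma eq_moment nu rho :
  (forall A : set (measurableTypeR R), measurable A -> nu A = rho A) ->
  moment nu = moment rho.
Proof.
by move=> h; apply/funext => n; apply: eq_measure_integral => A mA _; exact: h.
Qed.

Lemma eq_has_moments nu rho :
  (forall A : set (measurableTypeR R), measurable A -> nu A = rho A) ->
  has_moments nu <-> has_moments rho.
Proof.
move=> h; split => hm n; have := hm n; apply: le_lt_trans;
  by rewrite le_eqVlt; apply/orP; left; apply/eqP;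
     apply: eq_measure_integral => A mA _; rewrite h.
Qed.

Lemma weighted_atoms rho x a k : (forall i, 0 <= x i)%R ->
  (forall i, 0 <= a i)%R ->
  (forall A : set (measurableTypeR R), measurable A ->
     rho A = atoms (x : nat -> measurableTypeR R) a A) ->
  forall A : set (measurableTypeR R), measurable A ->
    weighted rho 0%R k A =
    atoms (x : nat -> measurableTypeR R) (fun i => a i * x i ^+ (2 * k))%R A.
Proof.
move=> x0 a0 rE A mA; rewrite /weighted.
rewrite (eq_measure_integral (atoms (x : nat -> measurableTypeR R) a)); last first.
  by move=> B mB _; exact: rE.
rewrite integral_atoms//; last 2 first.
- by move=> t; rewrite lee_fin weight_ge0.
- exact: (measurable_funS measurableT _ (measurable_weight 0%R k)).
rewrite atomsE//; last by move=> i; rewrite mulr_ge0 ?exprn_ge0.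
apply: eq_eseriesr => i _; rewrite [X in _ * X]muleC muleA -EFinM.
rewrite /weight subr0 /= expr0n/= addr0 sqrtr_sqr ger0_norm//.
Qed.

Lemma H_determinate_measure_weighted rho x a k : (forall i, 0 <= x i)%R ->
  (forall i, 0 <= a i)%R ->
  (forall A : set (measurableTypeR R), measurable A ->
     rho A = atoms (x : nat -> measurableTypeR R) a A) ->
  H_determinate_measure (weighted rho 0%R k) <->
  H_determinate_measure
    (atoms (x : nat -> measurableTypeR R) (fun i => a i * x i ^+ (2 * k))%R).
Proof.
move=> x0 a0 /(weighted_atoms k x0 a0) wE.
by rewrite /H_determinate_measure (eq_moment wE) (eq_has_moments wE).
Qed.

End moments.

(** * Determinacy of lacunary measures *)

Section poly_moments.
Context {R : realType}.
Implicit Types (nu rho : borel_measure R) (p : {poly R}).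

Lemma integrable_expr nu n : has_moments nu ->
  nu.-integrable setT (fun t : measurableTypeR R => ((t : R) ^+ n)%:E).
Proof.
move=> hm; apply/integrableP; split; first exact: measurable_expr.
by under eq_integral do rewrite abse_EFin normrX; exact: hm.
Qed.

Lemma integrable_sum_expr nu n (c : nat -> R) : has_moments nu ->
  nu.-integrable setT
    (fun t : measurableTypeR R => (\sum_(i < n) c i * (t : R) ^+ i)%:E).
Proof.
move=> hm; elim: n => [|n ih].
  by under eq_fun do rewrite big_ord0; exact: integrable0.
under eq_fun do rewrite big_ord_recr/= EFinD EFinM.
by apply: integrableD => //; apply: integrableZl => //; exact: integrable_expr.
Qed.

Lemma integral_sum_expr nu rho n (c : nat -> R) :
  has_moments nu -> has_moments rho -> moment nu = moment rho ->
  \int[nu]_t (\sum_(i < n) c i * (t : R) ^+ i)%:E =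
  \int[rho]_t (\sum_(i < n) c i * (t : R) ^+ i)%:E.
Proof.
move=> hn hr E; elim: n => [|n ih].
  under eq_integral do rewrite big_ord0; under [RHS]eq_integral do rewrite big_ord0.
  by rewrite !integral0.
under eq_integral do rewrite big_ord_recr/= EFinD EFinM.
under [RHS]eq_integral do rewrite big_ord_recr/= EFinD EFinM.
rewrite !integralD//=; try exact: integrable_sum_expr;
  try by apply: integrableZl => //; exact: integrable_expr.
rewrite ih !integralZl//; try exact: integrable_expr.
by congr (_ + _ * _); exact: (congr1 (fun f => f n) E).
Qed.

Lemma integral_poly nu rho p :
  has_moments nu -> has_moments rho -> moment nu = moment rho ->
  \int[nu]_t (p.[t])%:E = \int[rho]_t (p.[t])%:E.
Proof.
move=> hn hr E; under eq_integral do rewrite horner_coef.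
by under [RHS]eq_integral do rewrite horner_coef; exact: integral_sum_expr.
Qed.

Lemma measurable_horner p :
  measurable_fun setT (fun t : measurableTypeR R => (p.[t : R])%:E).
Proof.
under eq_fun do rewrite horner_coef; apply/measurable_EFinP.
by apply: measurable_sum => i; apply: measurable_funM.
Qed.

End poly_moments.

Section lacunary.
Context {R : realType} (x : nat -> R).
Hypotheses (x0 : (0 < x 0%N)%R) (xD : forall k, (2 * x k <= x k.+1)%R).

Lemma lacunary_gt0 k : (0 < x k)%R.
Proof. by elim: k => // k ih; have := xD k; lra. Qed.

Lemma lacunary_double j k : (k < j)%N -> (2 * x k <= x j)%R.
Proof.
elim: j => // j ih; rewrite ltnS leq_eqVlt => /orP[/eqP<-//|/ih h].
by have := xD j; have := lacunary_gt0 j; lra.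
Qed.

Lemma lacunary_inj : injective x.
Proof.
move=> i j e; have [h|h|//] := ltngtP i j; exfalso.
- by have := lacunary_double h; rewrite e; have := lacunary_gt0 j; lra.
- by have := lacunary_double h; rewrite e; have := lacunary_gt0 j; lra.
Qed.

Lemma lacunary_expn k : (x 0%N * 2 ^+ k <= x k)%R.
Proof.
elim: k => [|k ih]; first by rewrite expr0 mulr1.
by apply: le_trans (xD k); rewrite exprS mulrCA ler_pM2l.
Qed.

(** Both uses of these partial products are covered: for [s] off the sequence
    no factor is left out, and for [s] on it exactly one is. *)
Definition root_poly (s : R) n : {poly R} :=
  (\prod_(k < n | x k != s) (1 - (x k)^-1 *: 'X))%R.

Lemma horner_root_poly s n t :
  ((root_poly s n).[t] = \prod_(k < n | x k != s) (1 - t / x k))%R.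
Proof.
rewrite horner_prod; apply: eq_bigr => k _.
by rewrite !hornerE mulrC.
Qed.

Lemma root_poly_root s n j : (j < n)%N -> x j != s ->
  ((root_poly s n).[x j] = 0)%R.
Proof.
move=> jn js; rewrite horner_root_poly (bigD1 (Ordinal jn))//=.
by rewrite divff ?subrr ?mul0r// gt_eqF// lacunary_gt0.
Qed.

(** All the factors $x_j/x_k-1$ are at least 1, so adding factors only
    increases the product. *)
Lemma root_poly_tail s n j : (n <= j)%N ->
  ((root_poly s n).[x j] ^+ 2 <= (\prod_(k < j) (x j / x k - 1)) ^+ 2)%R.
Proof.
move=> nj; have ge1 (k : 'I_j) : (1 <= x j / x k - 1)%R.
  have xk := lacunary_gt0 k; rewrite lerBrDr ler_pdivlMr//.
  exact: lacunary_double (ltn_ord k).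
have prod_ge0 : (0 <= \prod_(k < j) (x j / x k - 1))%R.
  by apply: prodr_ge0 => k _; exact: le_trans (ge1 k).
rewrite -[leLHS]real_normK ?num_real// lerXn2r ?nnegrE//.
rewrite horner_root_poly normr_prod.
rewrite (big_ord_widen_cond j (fun k => x k != s) (fun k => `|1 - x j / x k|%R))//.
rewrite big_mkcond/=; apply: ler_prod => k _; case: ifP => _; last by rewrite ler01/=.
by rewrite normr_ge0 distrC ger0_norm ?lexx// (le_trans _ (ge1 k)).
Qed.

(** The infinite product of the factors $1-s/x_k\ne0$ converges to a nonzero
    limit, since $\sum_k 1/x_k<\infty$. *)
Lemma root_poly_lower s : exists c : R, (0 < c)%R /\
  exists K, forall n, (K <= n)%N -> (c <= (root_poly s n).[s] ^+ 2)%R.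
Proof.
pose f k : R := if x k != s then (1 - s / x k)%R else 1%R.
have fE n : ((root_poly s n).[s] = \prod_(k < n) f k)%R.
  by rewrite horner_root_poly big_mkcond.
have f_neq0 k : f k != 0%R.
  rewrite /f; case: ifPn => [|_]; last exact: oner_neq0.
  have xk := lacunary_gt0 k; rewrite subr_eq0; apply: contraNneq => h.
  by rewrite -[s](@divfK _ (x k)) -?h ?mul1r// gt_eqF.
pose K := Num.Def.archi_bound (4 * `|s| / x 0%N)%R.
have fK i : (1 - 2^-1 ^+ i / 4 <= f (K + i)%N)%R.
  have e0 : (0 <= 2^-1 ^+ i :> R)%R by rewrite exprn_ge0.
  rewrite /f; case: ifPn => _; last by lra.
  rewrite lerD2l lerN2 ler_pdivrMr ?lacunary_gt0//.
  apply: le_trans (ler_norm s) _.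
  have : (4 * `|s| / x 0%N < 2 ^+ K)%R by exact: upper_nthrootP.
  rewrite ltr_pdivrMr// => h.
  have : (2^-1 ^+ i * (x 0%N * 2 ^+ (K + i)) <= 2^-1 ^+ i * x (K + i)%N)%R.
    by rewrite ler_wpM2l// lacunary_expn.
  have -> : (2^-1 ^+ i * (x 0%N * 2 ^+ (K + i)) = 2 ^+ K * x 0%N)%R.
    by rewrite exprD exprVn; field; rewrite expf_neq0.
  by lra.
have prK m : (2^-1 + 2^-1 ^+ m / 2 <= \prod_(i < m) f (K + i)%N)%R.
  elim: m => [|m ih]; first by rewrite big_ord0 expr0; lra.
  rewrite big_ord_recr/=; have := fK m.
  have : (0 <= 2^-1 ^+ m :> R)%R by rewrite exprn_ge0.
  have : (2^-1 ^+ m <= 1 :> R)%R by rewrite exprn_ile1//; lra.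
  rewrite exprS; move: ih; set p := (\prod_(i < m) _)%R; set e := (2^-1 ^+ m)%R.
  by move: (f _) => y; nra.
pose c := (\prod_(k < K) f k)%R.
have c_neq0 : c != 0%R by apply/prodf_neq0 => k _.
exists (c ^+ 2 / 4)%R; split; first by rewrite divr_gt0// exprn_even_gt0.
exists K => n Kn; rewrite fE -(subnKC Kn) big_split_ord/= -/c exprMn.
rewrite ler_pM2l ?exprn_even_gt0//; have := prK (n - K)%N.
have : (0 <= 2^-1 ^+ (n - K) :> R)%R by rewrite exprn_ge0.
by set p := (\prod_(i < _) _)%R; move: p => p; nra.
Qed.

Variables (a u : nat -> R).
Hypotheses (a0 : forall k, (0 <= a k)%R) (u0 : forall k, (0 <= u k)%R).
Hypothesis usum : \sum_(k <oo) (u k)%:E < +oo.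
Hypothesis ua : forall j, ((\prod_(k < j) (x j / x k - 1)) ^+ 2 * a j <= u j)%R.

Let nu : borel_measure R := atoms (x : nat -> measurableTypeR R) a.

Let tail n := \sum_(n <= k <oo) (u k)%:E.

Let mroot2 s n : measurable_fun setT
  (fun t : measurableTypeR R => ((root_poly s n).[t : R] ^+ 2)%:E).
Proof.
by under eq_fun do rewrite -horner_exp; exact: measurable_horner.
Qed.

(** Up to the mass at [s], only the atoms of rank at least [n] contribute, the
    polynomial vanishing at the other ones. *)
Lemma integral_root_poly s n :
  \int[nu]_t ((root_poly s n).[t] ^+ 2)%:E <=
  nu [set s] * ((root_poly s n).[s] ^+ 2)%:E + tail n.
Proof.
rewrite integralT_atoms//; last by move=> t; rewrite lee_fin sqr_ge0.
rewrite atomsE// muleC -nneseriesZl; last by move=> i _; rewrite mule_ge0// lee_fin.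
rewrite /tail [X in _ <= _ + X]eseries_cond/= [X in _ <= _ + X]eseries_mkcond.
rewrite -nneseriesD; last 2 first.
- by move=> i _ _; rewrite !mule_ge0// lee_fin ?sqr_ge0.
- by move=> i _ _; case: ifP => // _; rewrite lee_fin.
apply: lee_nneseries => [j _ _|j _]; first by rewrite mule_ge0// lee_fin// sqr_ge0.
have [js|js] := eqVneq (x j) s.
  rewrite js diracE mem_set// mule1 muleC -[leLHS]adde0 leeD2l//.
  by case: ifP => // _; rewrite lee_fin.
have [nj|jn] := leqP n j; last first.
  by rewrite root_poly_root// expr0n/= mule0 adde0 !mule_ge0// lee_fin// sqr_ge0.
rewrite -[leLHS]add0e; apply: leeD; first by rewrite !mule_ge0// lee_fin// sqr_ge0.
rewrite -EFinM lee_fin; apply: le_trans (ua j); rewrite mulrC ler_wpM2r//.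
exact: root_poly_tail.
Qed.

Hypothesis nu_moments : has_moments nu.
Variable rho : borel_measure R.
Hypotheses (rho_moments : has_moments rho) (rhoE : moment rho = moment nu).

Let integral_rho s n :
  \int[rho]_t ((root_poly s n).[t] ^+ 2)%:E <=
  nu [set s] * ((root_poly s n).[s] ^+ 2)%:E + tail n.
Proof.
apply: le_trans (integral_root_poly s n).
under eq_integral do rewrite -horner_exp.
rewrite (integral_poly _ rho_moments nu_moments rhoE)//.
by under eq_integral do rewrite horner_exp.
Qed.

Let rho_fin : rho setT = nu setT /\ nu setT < +oo.
Proof.
have h (m : borel_measure R) : moment m 0%N = m setT.
  by rewrite /moment; under eq_integral do rewrite expr0; rewrite integral_cst// mul1e.
rewrite -!h rhoE; split => //; rewrite h; have := nu_moments 0%N.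
by under eq_integral do rewrite expr0; rewrite integral_cst// mul1e.
Qed.

Let markov s n (A : set (measurableTypeR R)) (c : R) : measurable A -> (0 <= c)%R ->
  (forall t, A t -> (c <= (root_poly s n).[t] ^+ 2)%R) ->
  c%:E * rho A <= nu [set s] * ((root_poly s n).[s] ^+ 2)%:E + tail n.
Proof.
move=> mA c0 cA; apply: le_trans (integral_rho s n).
rewrite -integral_cst//.
have f0 t : 0 <= ((root_poly s n).[t] ^+ 2)%:E by rewrite lee_fin sqr_ge0.
apply: le_trans (@ge0_subset_integral _ _ _ rho A setT mA measurableT _ (mroot2 s n) _ _) => //.
apply: ge0_le_integral => //.
- exact: measurable_funS (mroot2 s n).
Qed.

Let tail_small (e : R) : (0 < e)%R -> exists N, forall n, (N <= n)%N -> tail n <= e%:E.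
Proof. by apply: nneseries_tail_small => // k; rewrite lee_fin. Qed.

Let nu_set1 s : (forall k, x k != s) -> nu [set s] = 0.
Proof.
move=> xs; apply: atoms0 => // k _ /= xk.
by have := xs k; rewrite xk eqxx.
Qed.

Let mrange : measurable (range x : set (measurableTypeR R)).
Proof.
rewrite (_ : range x = \bigcup_k [set x k]).
  exact: bigcup_measurable.
by apply/seteqP; split => [t [k _ <-]|t [k _ ->]]; [exists k|exists k].
Qed.

(** Markov's inequality for the squares of the partial products: their
    integrals tend to 0, while off the atoms they stay away from 0. *)
Let rho_off : rho (~` range x) = 0.
Proof.
pose U i : set (measurableTypeR R) := \bigcap_(n in [set n | (i <= n)%N])
  [set t | (i.+1%:R^-1 <= (root_poly 0 n).[t] ^+ 2)%R].
have mU i : measurable (U i).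
  apply: bigcap_measurable => [|n _]; first by exists i; rewrite /= leqnn.
  have := mroot2 0%R n; move/measurable_EFinP => /(_ measurableT (`[i.+1%:R^-1, +oo[%classic)%R).
  rewrite setTI => h; rewrite (_ : [set t | _] =
    (fun t => (root_poly 0 n).[t] ^+ 2)%R @^-1` (`[i.+1%:R^-1, +oo[%classic)%R).
    exact: h.
  by apply/seteqP; split => t /=; rewrite in_itv/= andbT.
have U0 i : rho (U i) = 0.
  apply/eqP; rewrite eq_le measure_ge0 andbT; apply/lee_addgt0Pr => e e0.
  have [|N hN] := @tail_small (e / i.+1%:R)%R; first by rewrite divr_gt0.
  have n_ge : (maxn i N >= i)%N by rewrite leq_maxl.
  have := @markov 0%R (maxn i N) (U i) (i.+1%:R^-1)%R (mU i).
  rewrite nu_set1 => [|k]; last by rewrite gt_eqF// lacunary_gt0.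
  rewrite mul0e !add0e invr_ge0 ler0n => /(_ isT) h.
  have {}h : (i.+1%:R^-1)%:E * rho (U i) <= (e / i.+1%:R)%:E.
    apply: le_trans (h _) (hN _ (leq_maxr _ _)) => t; exact.
  rewrite -(@lee_pmul2l _ (i.+1%:R^-1)%:E)//.
  by rewrite -EFinM mulrC.
apply/eqP; rewrite eq_le measure_ge0 andbT.
rewrite (_ : 0%E = \sum_(i <oo) rho (U i)); last by rewrite eseries0.
apply: measure_sigma_subadditive => //; first exact: measurableC.
move=> t /= xt; have [c [c0 [K hK]]] := root_poly_lower t.
pose i := maxn K (Num.Def.archi_bound (c^-1)).
exists i => // n /= ni; have -> : root_poly 0 n = root_poly t n.
  apply: eq_bigl => k; rewrite gt_eqF ?lacunary_gt0//; apply/esym/eqP => xk.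
  by apply: xt; exists k.
apply: le_trans (hK n _); last by rewrite (leq_trans _ ni)// leq_maxl.
rewrite -[leRHS]invrK lef_pV2 ?posrE ?invr_gt0//.
apply: le_trans (ltW (archi_boundP _)) _; first by rewrite invr_ge0 ltW.
by rewrite ler_nat (leq_trans (leq_maxr K _)).
Qed.

(** The polynomial vanishing at the other points, which stays away from 0 at
    $x_k$, is tested against both measures. *)
Let rho_on k : rho [set x k] <= (a k)%:E.
Proof.
have [c [c0 [K hK]]] := root_poly_lower (x k).
apply/lee_addgt0Pr => e e0.
have [|N hN] := @tail_small (c * e)%R; first by rewrite mulr_gt0.
pose n := maxn K N; pose v := ((root_poly (x k) n).[x k] ^+ 2)%R.
have cv : (c <= v)%R by apply: hK; rewrite leq_maxl.
have v0 : (0 < v)%R by exact: lt_le_trans cv.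
have := @markov (x k) n [set x k] v (measurable_set1 _) (ltW v0).
rewrite /nu atoms_set1//; last exact: lacunary_inj.
move=> h; rewrite -(@lee_pmul2l _ v%:E)//.
apply: le_trans (h _) _ => [t ->//|].
rewrite -/v muleDr// muleC leeD2l//; apply: le_trans (hN n (leq_maxr _ _)) _.
by rewrite -EFinM lee_fin ler_wpM2r// ltW.
Qed.

Lemma lacunary_le (A : set (measurableTypeR R)) : measurable A -> rho A <= nu A.
Proof.
move=> mA; pose B k : set (measurableTypeR R) := A `&` [set x k].
have mB k : measurable (B k) by exact: measurableI.
have AE : A `<=` \bigcup_k B k `|` ~` range x.
  move=> t At; have [[k _ xk]|] := pselect (range x t); last by right.
  by left; exists k => //; split.
have mBU : measurable (\bigcup_k B k) by exact: bigcup_measurable.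
apply: (@le_trans _ _ (rho (\bigcup_k B k `|` ~` range x))).
  by apply: le_measure; rewrite ?inE//; apply: measurableU => //; exact: measurableC.
apply: le_trans (measureU2 _ _ _) _ => //; first exact: measurableC.
rewrite -[leRHS]adde0; apply: leeD; last first.
  by rewrite le_eqVlt; apply/orP; left; apply/eqP; exact: rho_off.
rewrite /nu atomsE//.
apply: (@le_trans _ _ (\sum_(k <oo) rho (B k))).
  exact: measure_sigma_subadditive.
apply: lee_nneseries => // k _; rewrite diracE; have [xA|/negP xA] := boolP (x k \in A).
  rewrite mule1; apply: le_trans (rho_on k).
  by apply: le_measure; rewrite ?inE//; exact: subIsetr.
rewrite mule0 (_ : B k = set0) ?measure0//.
by apply/seteqP; split => // t [At tk]; apply: xA; rewrite -tk inE.
Qed.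

(** The inequality holds for a set and for its complement, and the total
    masses are equal and finite. *)
Lemma lacunary_eq (A : set (measurableTypeR R)) : measurable A -> rho A = nu A.
Proof.
move=> mA; have mAC : measurable (~` A) by exact: measurableC.
have [rhoT nufin] := rho_fin.
have splitT (m : borel_measure R) : m setT = m A + m (~` A).
  by rewrite -measureU// ?setUv// setICr.
apply/eqP; rewrite eq_le lacunary_le//= leNgt; apply/negP => lt.
have rhoCfin : rho (~` A) \is a fin_num.
  rewrite ge0_fin_numE//; apply: le_lt_trans nufin.
  by rewrite -rhoT splitT leeDr.
have : rho setT < nu setT.
  by rewrite !splitT; apply: lte_leD => //; exact: lacunary_le.
by rewrite rhoT ltxx.
Qed.

End lacunary.

(** The hypothesis on [u] says that the $n$-th partial product of
    $\prod_k(1-t/x_k)$ is small in $L^2$: at $x_j$ with $j\ge n$ its square is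
    at most the square of the product over $k<j$. *)
Lemma lacunary_determinate (R : realType) (x a u : nat -> R) :
  (0 < x 0%N)%R -> (forall k, (2 * x k <= x k.+1)%R) ->
  (forall k, (0 <= a k)%R) -> (forall k, (0 <= u k)%R) ->
  \sum_(k <oo) (u k)%:E < +oo ->
  (forall j, ((\prod_(k < j) (x j / x k - 1)) ^+ 2 * a j <= u j)%R) ->
  has_moments (atoms (x : nat -> measurableTypeR R) a) ->
  H_determinate_measure (atoms (x : nat -> measurableTypeR R) a).
Proof.
move=> x0 xD a0 u0 usum ua hm; split => //.
exists (atoms (x : nat -> measurableTypeR R) a); first by split.
move=> rho [rho_m rhoE] A mA; apply: (lacunary_eq x0 xD a0 u0 usum ua hm rho_m) => //.
by apply/funext => n.
Qed.

(** * Index of determinacy of atomic measures *)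

Section index.
Context {R : realType}.
Implicit Types (x a : nat -> R) (nu rho : borel_measure R).
Local Notation atomsR x a := (atoms (x : nat -> measurableTypeR R) a).

Lemma H_determinate_unique nu rho gamma : H_determinate gamma ->
  H_representing nu gamma -> H_representing rho gamma ->
  forall A : set (measurableTypeR R), measurable A -> rho A = nu A.
Proof. by move=> [m _ u] /u nuE /u rhoE A mA; rewrite nuE// rhoE. Qed.

Section with_atoms.
Variables (x a : nat -> R).
Hypotheses (x_ge0 : forall k, (0 <= x k)%R) (a_ge0 : forall k, (0 <= a k)%R).
Local Notation det k := (H_determinate_measure
  (atomsR x (fun i => a i * x i ^+ (2 * k))%R)).

Lemma atoms_weight0 : (fun i => a i * x i ^+ (2 * 0))%R = a.
Proof. by apply/funext => i; rewrite muln0 expr0 mulr1. Qed.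

Lemma ind_atoms rho : det 0 -> H_representing rho (moment (atomsR x a)) ->
  ind 0%R rho = ereal_sup [set (k%:R)%:E | k in [set k | det k]].
Proof.
rewrite atoms_weight0 => -[hm hd] hr; congr ereal_sup.
have hE : H_representing (atomsR x a) (moment (atomsR x a)) by [].
have := H_determinate_unique hd hE hr.
move=> rE; congr (image _ _); apply/funext => k /=; apply/propext.
exact: H_determinate_measure_weighted.
Qed.

Lemma atoms_index K : (forall k, det k <-> (k <= K)%N) ->
  H_determinate_with_index (moment (atomsR x a)) 0%R (K%:R)%:E.
Proof.
move=> dK; have d0 : det 0 by apply/dK.
split; first by move: d0; rewrite atoms_weight0 => -[].
move=> rho /(ind_atoms d0) ->.
apply/eqP; rewrite eq_le; apply/andP; split.
  apply: ge_ereal_sup => _ /= [k /dK kK <-].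
  by rewrite lee_fin ler_nat.
by apply: ereal_sup_ubound; exists K => //=; apply/dK.
Qed.

Lemma atoms_infinite_index : (forall k, det k) ->
  H_determinate_infinite_index (moment (atomsR x a)).
Proof.
move=> dk; exists 0%R; have d0 := dk 0%N.
split; first by move: d0; rewrite atoms_weight0 => -[].
move=> rho /(ind_atoms d0) ->.
apply/eqyP => r r0; apply: (@le_trans _ _ (Num.Def.archi_bound r)%:R%:E).
  by rewrite lee_fin ltW// archi_boundP// ltW.
by apply: ereal_sup_ubound; exists (Num.Def.archi_bound r) => //; exact: dk.
Qed.

End with_atoms.

(** A point mass, presented as a lacunary sequence of atoms of which only the
    first one is charged. *)
Definition point_mass (y : R) : borel_measure R :=
  atomsR (fun k => y * 2 ^+ k)%R (fun k => (k == 0%N)%:R).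

Lemma point_mass_determinate (y c : R) : (0 < y)%R -> (0 <= c)%R ->
  H_determinate_measure
    (atomsR (fun k => y * 2 ^+ k)%R (fun k => c * (k == 0%N)%:R)%R).
Proof.
move=> y0 c0; pose u k := (c / 2 ^+ k)%R.
have x0 k : (0 <= y * 2 ^+ k)%R by rewrite mulr_ge0 ?exprn_ge0// ltW.
have a0 k : (0 <= c * (k == 0%N)%:R)%R by rewrite mulr_ge0.
apply: (@lacunary_determinate _ _ _ u) => //.
- by rewrite expr0 mulr1.
- by move=> k; rewrite exprS mulrCA.
- by move=> k; rewrite divr_ge0// exprn_ge0.
- by rewrite nneseries_half// ltry.
- case=> [|j]; first by rewrite big_ord0 expr1n mul1r /u expr0 mulr1 divr1.
  by rewrite !mulr0 divr_ge0// exprn_ge0.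
- apply: has_moments_neg => [|n]; first exact: atoms_neg.
  rewrite moment_atoms// nneseries_recl0 => [|k].
    by rewrite eseries0 ?adde0 ?ltry// => k _ _; rewrite mulr0 mul0r.
  by rewrite lee_fin mulr_ge0// exprn_ge0.
Qed.

Lemma moment_point_mass (y : R) n : (0 < y)%R ->
  moment (point_mass y) n = (y ^+ n)%:E.
Proof.
move=> y0; have x0 k : (0 <= y * 2 ^+ k)%R by rewrite mulr_ge0 ?exprn_ge0// ltW.
rewrite moment_atoms// nneseries_recl0 => [|k]; last first.
  by rewrite lee_fin mulr_ge0// exprn_ge0.
by rewrite expr0 mulr1 mul1r eseries0 ?adde0// => k _ _; rewrite mul0r.
Qed.

Lemma point_mass_infinite_index (y : R) : (0 < y)%R ->
  H_determinate_infinite_index (moment (point_mass y)).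
Proof.
move=> y0; apply: atoms_infinite_index => // k.
  by rewrite mulr_ge0 ?exprn_ge0// ltW.
have -> : (fun i => (i == 0%N)%:R * (y * 2 ^+ i) ^+ (2 * k))%R =
          (fun i => y ^+ (2 * k) * (i == 0%N)%:R)%R :> (nat -> R).
  by apply/funext => -[|i]; rewrite ?mul0r ?mulr0// expr0 mulr1 mul1r mulr1.
by apply: point_mass_determinate; rewrite ?exprn_ge0// ltW.
Qed.

End index.

(** * Measures on the lattice of powers of b *)

Section qseries.
Context {R : realType} (b : R).
Hypothesis b2 : (2 <= b)%R.

Let b_gt0 : (0 < b)%R. Proof. exact: lt_le_trans b2. Qed.
Let b_ge0 : (0 <= b)%R. Proof. exact: ltW. Qed.
Let b_neq1 : b != 1%R. Proof. by rewrite gt_eqF// (lt_le_trans _ b2)// ltr1n. Qed.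
Let b_ge1 : (1 <= b)%R. Proof. by apply: le_trans b2; rewrite ler1n. Qed.

(** Up to a power of $b-1$, the $q$-factorial for $q=b$. *)
Definition qfact m : R := (\prod_(l < m) (b ^+ l.+1 - 1))%R.

Lemma qfact0 : qfact 0 = 1%R. Proof. exact: big_ord0. Qed.

Lemma qfactS m : (qfact m.+1 = qfact m * (b ^+ m.+1 - 1))%R.
Proof. by rewrite /qfact big_ord_recr. Qed.

Lemma expr_b_ge m n : (m <= n)%N -> (b ^+ m <= b ^+ n)%R.
Proof. by move=> mn; rewrite ler_weXn2l. Qed.

Lemma qfactor_ge1 m : (1 <= b ^+ m.+1 - 1)%R.
Proof. by have := @expr_b_ge 1 m.+1 isT; rewrite expr1; have := b2; lra. Qed.

Lemma qfact_gt0 m : (0 < qfact m)%R.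
Proof.
elim: m => [|m ih]; first by rewrite qfact0.
by rewrite qfactS mulr_gt0//; have := qfactor_ge1 m; lra.
Qed.

Lemma qfact_neq0 m : qfact m != 0%R.
Proof. by rewrite gt_eqF// qfact_gt0. Qed.

Lemma qfact_ge m : (2 ^+ m <= qfact m.*2)%R.
Proof.
elim: m => [|m ih]; first by rewrite qfact0.
rewrite doubleS !qfactS -mulrA exprSr.
apply: ler_pM => //.
rewrite -[leLHS]mul1r ler_pM// ?qfactor_ge1//.
have : (b ^+ 2 <= b ^+ m.*2.+2)%R by exact: expr_b_ge.
by rewrite expr2; have := b2; nra.
Qed.

Lemma qfact_le m : (qfact m <= qfact m.+1)%R.
Proof. by rewrite qfactS ler_peMr ?qfactor_ge1// ltW// qfact_gt0. Qed.

Lemma qfact_add m n :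
  (qfact m * b ^+ (m * n) <= qfact (m + n) <= qfact m * b ^+ ((m + n) * n))%R.
Proof.
suff h k : (k <= n)%N ->
    (qfact m * b ^+ (m * k) <= qfact (m + k) <= qfact m * b ^+ ((m + n) * k))%R.
  exact: h.
elim: k => [|k ih] kn; first by rewrite addn0 !muln0 expr0 mulr1 lexx.
have /andP[lo hi] := ih (ltnW kn).
have d0 := qfact_gt0 m; have d1 := qfact_gt0 (m + k).
have p0 e : (0 < b ^+ e)%R by rewrite exprn_gt0.
rewrite addnS qfactS !mulnS !exprD; apply/andP; split.
  rewrite [(b ^+ m * _)%R]mulrC mulrA ler_pM//; [by rewrite mulr_ge0 ?ltW| by rewrite ltW|].
  have : (b * b ^+ m <= b ^+ (m + k).+1)%R by rewrite -exprS expr_b_ge// ltnS leq_addr.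
  have : (1 <= b ^+ m)%R by exact: exprn_ege1.
  by have := b2; nra.
rewrite -exprD [(b ^+ (m + n) * _)%R]mulrC mulrA ler_pM//; first exact: ltW.
  by have := qfactor_ge1 (m + k); lra.
have : (b ^+ (m + k).+1 <= b ^+ (m + n))%R by rewrite expr_b_ge// -addnS leq_add2l.
by lra.
Qed.

(** For $n>0$ these two sums are the moments of order $n-1$ of the measure with
    masses $b^m/d_m$ at $b^m$, restricted to even, respectively odd, $m$. *)
Definition even_sum n : \bar R :=
  \sum_(k <oo) (b ^+ (k.*2 * n) / qfact k.*2)%:E.

Definition odd_sum n : \bar R :=
  \sum_(k <oo) (b ^+ (k.*2.+1 * n) / qfact k.*2.+1)%:E.

Lemma qterm_ge0 m n : (0 <= b ^+ n / qfact m)%R.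
Proof. by rewrite divr_ge0 ?exprn_ge0// ltW// qfact_gt0. Qed.

Lemma odd_sum_ge0 n : 0 <= odd_sum n.
Proof. by apply: nneseries_ge0 => k _ _; rewrite lee_fin qterm_ge0. Qed.

Lemma qterm_rec m n : (b ^+ (m.+1 * n.+1) / qfact m.+1 =
  b ^+ (m.+1 * n) / qfact m.+1 + b ^+ n * (b ^+ (m * n) / qfact m))%R.
Proof.
rewrite qfactS mulnS exprD mulSn exprD; field.
have := qfactor_ge1 m; rewrite qfact_neq0/= => h.
by rewrite gt_eqF//; lra.
Qed.

Lemma even_sumS n : even_sum n.+1 = even_sum n + (b ^+ n)%:E * odd_sum n.
Proof.
have e0 k i : 0 <= (b ^+ k / qfact i)%:E by rewrite lee_fin qterm_ge0.
rewrite /even_sum nneseries_recl0// [in RHS]nneseries_recl0//.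
rewrite /odd_sum -nneseriesZl// -addeA -nneseriesD//; last first.
  by move=> i _ _; rewrite mule_ge0// lee_fin exprn_ge0.
congr (_ + _); apply: eq_eseriesr => k _.
by rewrite doubleS qterm_rec EFinD EFinM.
Qed.

Lemma odd_sumS n : odd_sum n.+1 = odd_sum n + (b ^+ n)%:E * even_sum n.
Proof.
have e0 k i : 0 <= (b ^+ k / qfact i)%:E by rewrite lee_fin qterm_ge0.
rewrite /even_sum /odd_sum -nneseriesZl// -nneseriesD//; last first.
  by move=> i _ _; rewrite mule_ge0// lee_fin exprn_ge0.
by apply: eq_eseriesr => k _; rewrite qterm_rec EFinD EFinM.
Qed.

(** The recursions exchange the two sums, and $b^0=1$ makes them agree from
    order 1 on. *)
Lemma even_odd_sum n : even_sum n.+1 = odd_sum n.+1.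
Proof.
elim: n => [|n ih]; first by rewrite even_sumS odd_sumS !mul1e addeC.
by rewrite (even_sumS n.+1) (odd_sumS n.+1) ih.
Qed.

(** By the recursions, finiteness at order 0 propagates to all orders. *)
Lemma even_odd_fin n : even_sum n < +oo /\ odd_sum n < +oo.
Proof.
elim: n => [|n [e o]]; last first.
  by rewrite even_sumS odd_sumS; split; apply: lte_add_pinfty => //;
     apply: lte_mul_pinfty => //; rewrite lee_fin exprn_ge0.
have h i m : (m.*2 <= i <= m.*2.+1)%N -> (b ^+ (i * 0) / qfact i <= 1 / 2 ^+ m)%R.
  move=> im; rewrite muln0 expr0 !div1r lef_pV2 ?posrE ?exprn_gt0 ?qfact_gt0//.
  have := qfact_ge m; have := qfact_le m.*2.
  have [->|->] : i = m.*2 \/ i = m.*2.+1 by lia.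
  - by [].
  - by move=> /[swap]; exact: le_trans.
split; (apply: (@le_lt_trans _ _ (2 * 1)%:E); last by rewrite ltry);
  apply: nneseries_fin_half => // k; rewrite lee_fin ?qterm_ge0// h//; lia.
Qed.

(** The masses of the odd half of the lattice; they separate determinacy from
    indeterminacy on every dilated copy of that half. *)
Definition critical k : R := (b ^+ k.*2.+1 / qfact k.*2.+1)%R.

Lemma critical_gt0 k : (0 < critical k)%R.
Proof. by rewrite divr_gt0 ?exprn_gt0// qfact_gt0. Qed.

Lemma odd_sum_critical n :
  odd_sum n.+1 = \sum_(k <oo) (critical k * (b ^+ k.*2.+1) ^+ n)%:E.
Proof.
by apply: eq_eseriesr => k _; rewrite mulnS exprD exprM /critical mulrAC.
Qed.

(** The left-hand product is $\prod_{l\le j}(b^{2l}-1)$.  One copy of it occurs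
    in $d_{2j+1}$ as the even factors; in the other one each factor is replaced
    by the next odd one, which gains a factor $b$. *)
Lemma odd_lattice_product j : ((\prod_(k < j) (b ^+ (j - k).*2 - 1)) ^+ 2 * b ^+ j
  <= qfact j.*2.+1)%R.
Proof.
rewrite (reindex_inj rev_ord_inj)/=.
under eq_bigr => k _ do rewrite subKn//.
elim: j => [|j ih].
  by rewrite big_ord0 expr0 expr1n mul1r; have := qfactor_ge1 0; rewrite qfactS qfact0 mul1r.
rewrite big_ord_recr/= doubleS !qfactS.
rewrite exprMn [(b ^+ j.+1)%R]exprS.
rewrite [leLHS](_ : _ = ((\prod_(i < j) (b ^+ i.+1.*2 - 1)) ^+ 2 * b ^+ j) *
   ((b ^+ j.+1.*2 - 1) ^+ 2 * b))%R; last by ring.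
rewrite -[leRHS]mulrA; apply: ler_pM => //.
- by rewrite mulr_ge0 ?sqr_ge0// exprn_ge0.
- by rewrite mulr_ge0// sqr_ge0.
- by rewrite -qfactS.
have := qfactor_ge1 j.*2.+1.
rewrite expr2 -mulrA doubleS [(b ^+ j.*2.+3)%R]exprSr => h.
have := b2; rewrite ler_pM2l; nra.
Qed.

Section lattice.
Variables (theta : R) (a : nat -> R).
Hypothesis theta0 : (0 < theta)%R.
Let x k : R := (theta * b ^+ k.*2.+1)%R.
Let x_ge0 k : (0 <= x k)%R.
Proof. by rewrite mulr_ge0 ?exprn_ge0// ltW. Qed.

(** By [odd_lattice_product], these masses compensate the growth of the partial
    products up to a summable geometric sequence. *)
Lemma critical_determinate (C : R) : (forall k, (0 <= a k)%R) ->
  (forall k, (a k <= C * critical k / b ^+ k.*2)%R) ->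
  H_determinate_measure (atoms (x : nat -> measurableTypeR R) a).
Proof.
move=> a0 aC.
have C0 : (0 <= C)%R.
  have := le_trans (a0 0%N) (aC 0%N); rewrite expr0 divr1 pmulr_lge0//.
  exact: critical_gt0.
apply: (@lacunary_determinate _ _ _ (fun j => C * b / 2 ^+ j)%R) => //.
- by rewrite mulr_gt0// exprn_gt0.
- move=> k; rewrite /x doubleS.
  have -> : (b ^+ k.*2.+3 = b * (b * b ^+ k.*2.+1))%R by rewrite -!exprS.
  have := exprn_gt0 k.*2.+1 b_gt0; set y := (b ^+ _)%R => y0.
  by rewrite mulrCA ler_pM2l// mulrA ler_pM2r//; have := b2; nra.
- by move=> k; rewrite divr_ge0 ?exprn_ge0// mulr_ge0// ltW.
- by rewrite nneseries_half ?ltry// mulr_ge0// ltW.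
- move=> j.
  have xE (k : 'I_j) : (x j / x k - 1 = b ^+ (j - k).*2 - 1)%R.
    congr (_ - _)%R; rewrite /x; have kj := ltnW (ltn_ord k).
    have -> : j.*2.+1 = ((j - k).*2 + k.*2.+1)%N by lia.
    by rewrite exprD; field; rewrite !gt_eqF ?exprn_gt0.
  rewrite (eq_bigr _ (fun k _ => xE k)).
  set q := (_ ^+ 2)%R; have q0 : (0 <= q)%R by exact: sqr_ge0.
  have qd : (q * b ^+ j <= qfact j.*2.+1)%R by exact: odd_lattice_product.
  apply: (@le_trans _ _ (q * (C * critical j / b ^+ j.*2))%R); first by rewrite ler_wpM2l.
  have -> : (q * (C * critical j / b ^+ j.*2) = C * b * (q / qfact j.*2.+1))%R.
    rewrite /critical exprSr; field.
    by rewrite qfact_neq0 gt_eqF// exprn_gt0.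
  rewrite ler_wpM2l ?mulr_ge0 ?(ltW b_gt0)// ler_pdivrMr ?qfact_gt0//.
  rewrite ler_pdivlMl ?exprn_gt0//; apply: le_trans qd.
  by rewrite mulrC ler_wpM2l// lerXn2r ?nnegrE// ltW.
- apply: has_moments_neg; first exact: atoms_neg.
  move=> n; rewrite moment_atoms//.
  apply: (@le_lt_trans _ _ ((C * theta ^+ n)%:E * odd_sum n.+1)).
    rewrite odd_sum_critical -nneseriesZl; last first.
      by move=> k _; rewrite lee_fin mulr_ge0 ?exprn_ge0// ltW// critical_gt0.
    apply: lee_nneseries => [k _ _|k _].
      by rewrite lee_fin mulr_ge0// exprn_ge0.
    rewrite -EFinM lee_fin /x exprMn.
    set y := (theta ^+ n)%R; set e := ((b ^+ _) ^+ n)%R.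
    rewrite [leRHS](_ : _ = C * critical k * (y * e))%R; last by ring.
    rewrite ler_wpM2r ?mulr_ge0 ?exprn_ge0 ?(ltW theta0)//.
    apply: le_trans (aC k) _; rewrite ler_pdivrMr ?exprn_gt0// ler_peMr ?exprn_ege1//.
    by rewrite mulr_ge0// ltW// critical_gt0.
  apply: lte_mul_pinfty; rewrite ?lee_fin ?mulr_ge0 ?exprn_ge0 ?(ltW theta0)//.
  by have [] := even_odd_fin n.+1.
Qed.

(** By [even_odd_sum], part of the mass on the odd half of the lattice can be
    moved to the even half without changing any moment. *)
Lemma critical_indeterminate (kappa : R) : (0 < kappa)%R ->
  (forall k, (kappa * critical k <= a k)%R) ->
  ~ H_determinate_measure (atoms (x : nat -> measurableTypeR R) a).
Proof.
move=> k0 ak [hm [nu0 _ uniq]].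
set nu := atoms _ _ in hm uniq.
have kc k : (0 <= kappa * critical k)%R by rewrite mulr_ge0 ?ltW// critical_gt0.
have a0 k : (0 <= a k)%R by exact: le_trans (ak k).
(* [w] is what remains on the odd half, [v] what is put on the even half. *)
pose w k := (a k - kappa * critical k)%R.
have w0 k : (0 <= w k)%R by rewrite subr_ge0.
pose z k := (theta * b ^+ k.*2)%R.
have z0 k : (0 <= z k)%R by rewrite mulr_ge0 ?exprn_ge0 ?(ltW theta0).
pose v k := (kappa * (b ^+ k.*2 / qfact k.*2))%R.
have v0 k : (0 <= v k)%R by rewrite mulr_ge0 ?qterm_ge0// ltW.
pose mw : borel_measure R := atoms (x : nat -> measurableTypeR R) w.
pose mv : borel_measure R := atoms (z : nat -> measurableTypeR R) v.
pose rho : borel_measure R := measure_add mw mv.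
have rhoA A : rho A = mw A + mv A by exact: measure_addE.
have rho_neg : rho (`]-oo, 0%R[%classic) = 0.
  by rewrite rhoA /mw /mv !atoms_neg// adde0.
have term n c (y : R) : (kappa * (b ^+ c / y) * (theta * b ^+ c) ^+ n =
    kappa * theta ^+ n * (b ^+ (c * n.+1) / y))%R.
  by rewrite mulnS exprD exprM exprMn; ring.
have rhoE n : moment rho n = moment nu n.
  rewrite moment_abs// ge0_integral_measure_add//; last exact: measurable_abs_expr.
  rewrite -!moment_abs ?atoms_neg// !moment_atoms//.
  transitivity (\sum_(k <oo) (w k * x k ^+ n)%:E +
                (kappa * theta ^+ n)%:E * even_sum n.+1).
    congr (_ + _); rewrite /even_sum -nneseriesZl; last first.
      by move=> k _; rewrite lee_fin qterm_ge0.
    by apply: eq_eseriesr => k _; rewrite -EFinM term.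
  rewrite even_odd_sum /odd_sum -nneseriesZl; last first.
    by move=> k _; rewrite lee_fin qterm_ge0.
  rewrite -nneseriesD; last 2 first.
  - by move=> k _ _; rewrite lee_fin mulr_ge0// exprn_ge0.
  - by move=> k _ _; rewrite mule_ge0// lee_fin ?qterm_ge0// mulr_ge0 ?exprn_ge0// ltW.
  apply: eq_eseriesr => k _; rewrite -EFinM -term -EFinD -mulrDl.
  by rewrite /w subrK.
have nu_moment n : moment nu n < +oo.
  by rewrite moment_abs ?atoms_neg//; exact: hm.
have mset : measurable [set theta : measurableTypeR R] by exact: measurable_set1.
have : rho [set theta] = nu [set theta].
  rewrite (uniq rho _ _ mset) ?(uniq nu _ _ mset)//.
  split => [|n]; last by rewrite rhoE.
  by apply: has_moments_neg => // n; rewrite rhoE.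
rewrite (atoms0 mset a0) => [|k _]; last first.
  rewrite /= /x => /eqP; rewrite -subr_eq0 -[X in (_ - X)%R]mulr1 -mulrBr.
  by rewrite mulf_eq0 !gt_eqF//; have := qfactor_ge1 k.*2; lra.
apply/eqP; rewrite gt_eqF// rhoA.
rewrite [X in _ + X](_ : _ = (v 0%N)%:E).
  apply: lt_le_trans (_ : (v 0%N)%:E <= _); last by rewrite leeDr.
  by rewrite lte_fin /v mulr_gt0// divr_gt0 ?exprn_gt0// qfact_gt0.
have -> : [set theta] = [set z 0%N] :> set (measurableTypeR R).
  by rewrite /z expr0 mulr1.
rewrite /mv atoms_set1// => i j /(mulfI (lt0r_neq0 theta0)).
by move/(ieexprIn b_gt0 b_neq1)/double_inj.
Qed.

End lattice.

(** Dividing the critical masses by $x_k-1$ makes them just small enough for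
    determinacy, which one factor $t$ destroys. *)
Lemma loop_determinate (c : R) e : (0 < c)%R ->
  H_determinate_measure (atoms ((fun k => b ^+ k.*2.+1)%R : nat -> measurableTypeR R)
    (fun k => c * critical k / (b ^+ k.*2.+1 - 1) * (b ^+ k.*2.+1) ^+ e)%R)
  <-> e = 0%N.
Proof.
move=> c0; have -> : (fun k => b ^+ k.*2.+1)%R = (fun k => 1 * b ^+ k.*2.+1)%R.
  by apply/funext => k; rewrite mul1r.
split => [|->].
  case: e => // e; set a := (X in atoms _ X).
  have : ~ H_determinate_measure
      (atoms ((fun k => 1 * b ^+ k.*2.+1)%R : nat -> measurableTypeR R) a).
    apply: (@critical_indeterminate _ _ _ c) => // k.
    rewrite /a -mulrA ler_peMr//; first by rewrite mulr_ge0 ?ltW// critical_gt0.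
    have := qfactor_ge1 k.*2; set y := (b ^+ _)%R => y1.
    rewrite mulrC ler_pdivlMr; last by lra.
    rewrite mul1r; apply: (@le_trans _ _ y); first by lra.
    by rewrite exprS ler_peMr ?exprn_ege1//; lra.
  by move=> h /h.
apply: (@critical_determinate _ _ _ c) => // k.
  rewrite expr0 mulr1 divr_ge0//; first by rewrite mulr_ge0 ?ltW// critical_gt0.
  by have := qfactor_ge1 k.*2; lra.
rewrite expr0 mulr1 ler_wpM2l//; first by rewrite mulr_ge0 ?ltW// critical_gt0.
rewrite lef_pV2 ?posrE ?exprn_gt0//; last by have := qfactor_ge1 k.*2; lra.
rewrite exprS; have : (1 <= b ^+ k.*2)%R by exact: exprn_ege1.
by have := b2; nra.
Qed.

(** Dropping the first [r] atoms of the even half leaves a dilated copy of the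
    odd half, the dilation being $b^{2r-1}$.  By [qfact_add] the masses, relative
    to the critical ones, behave like $b^{2k(e-2r)}$ up to constants. *)
Lemma branch_determinate (c : R) r e : (0 < c)%R -> (0 < r)%N ->
  H_determinate_measure
    (atoms ((fun k => b ^+ (r + k).*2)%R : nat -> measurableTypeR R)
    (fun k => c * (b ^+ ((r + k).*2 * e) / qfact (r + k).*2))%R)
  <-> (e < r.*2)%N.
Proof.
move=> c0 r0; pose M := r.*2.-1; set a := (fun k => c * _)%R.
have rM : r.*2 = M.+1 by rewrite prednK// double_gt0.
have rk k : (r + k).*2 = (k.*2.+1 + M)%N by rewrite doubleD rM; lia.
have -> : (fun k => b ^+ (r + k).*2)%R = (fun k => b ^+ M * b ^+ k.*2.+1)%R.
  by apply/funext => k; rewrite rk addnC exprD.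
have dpos k : (0 < qfact k)%R by exact: qfact_gt0.
have epos n : (0 < b ^+ n)%R by rewrite exprn_gt0.
rewrite rM ltnS; split; [apply: contraPT; rewrite -ltnNge => Me | move=> eM].
  apply: (@critical_indeterminate _ _ _ c) => // k.
  have /andP[_ hi] := qfact_add k.*2.+1 M.
  rewrite /a rk ler_pM2l// /critical ler_pdivlMr//.
  apply: le_trans (ler_wpM2l (qterm_ge0 _ _) hi) _.
  rewrite mulrA divfK ?qfact_neq0// -exprD expr_b_ge//.
  by apply: leq_trans _ (leq_mul (leqnn _) Me); rewrite mulnS leq_add2r leq_addr.
apply: (@critical_determinate _ _ _ (c * b ^+ (M * M))%R) => // k.
  by rewrite mulr_ge0 ?qterm_ge0// ltW.
have /andP[lo _] := qfact_add k.*2.+1 M.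
have -> : (c * b ^+ (M * M) * critical k / b ^+ k.*2 =
           c * (b ^+ (M * M).+1 / qfact k.*2.+1))%R.
  by rewrite /critical !exprSr; field; rewrite qfact_neq0 gt_eqF.
rewrite /a rk ler_pM2l// ler_pdivrMr//.
apply: le_trans _ (ler_wpM2l (qterm_ge0 _ _) lo).
rewrite mulrA divfK ?qfact_neq0// -exprD expr_b_ge//.
by apply: leq_trans (leq_mul (leqnn _) eM) _; rewrite mulnDl addSn addnC leqW.
Qed.

End qseries.

(** * Composition operators on a countable space *)

Section countable.
Context d (X : measurableType d) (R : realType).
Hypothesis hmeas : forall A : set X, measurable A.
Variables (e : nat -> X) (mu : {measure set X -> \bar R}).
Hypotheses (e_inj : injective e) (e_surj : forall y, exists n, y = e n).

Lemma integral_cst_on (D : set X) (c : \bar R) (F : X -> \bar R) :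
  (forall y, D y -> F y = c) -> \int[mu]_(y in D) F y = c * mu D.
Proof.
by move=> Fc; rewrite -integral_cst//; apply: eq_integral => y; rewrite inE => /Fc.
Qed.

(** The fibers of [g] partition the space, and $F\circ g$ is constant on
    each of them. *)
Lemma integral_fibers (g : X -> X) (F : X -> \bar R) : (forall y, 0 <= F y) ->
  \int[mu]_y F (g y) = \sum_(n <oo) (F (e n) * mu (g @^-1` [set e n])).
Proof.
move=> F0; have -> : [set: X] = \bigcup_n (g @^-1` [set e n]).
  by apply/seteqP; split => // y _; have [n gy] := e_surj (g y); exists n.
rewrite ge0_integral_bigcup//.
- by apply: eq_eseriesr => n _; apply: integral_cst_on => y /= ->.
- by apply/trivIsetP => i j _ _ ij; apply/seteqP; split => // y [/= -> /e_inj/eqP];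
     rewrite (negbTE ij).
Qed.

Local Notation C := R[i].
Local Notation sqint f := (\int[mu]_y ((Normc.normc (f y)) ^+ 2)%:E).
Implicit Types (f g : X -> C).
Variable phi : X -> X.

Lemma sqnorm_ge0 f y : 0 <= (Normc.normc (f y) ^+ 2)%:E.
Proof. by rewrite lee_fin sqr_ge0. Qed.

Lemma sqint_fibers f (g : X -> X) : sqint (f \o g) =
  \sum_(m <oo) ((Normc.normc (f (e m)) ^+ 2)%:E * mu (g @^-1` [set e m])).
Proof. exact: (@integral_fibers g (fun y => (Normc.normc (f y) ^+ 2)%:E) (sqnorm_ge0 f)). Qed.

Lemma sqint_sum f : sqint f =
  \sum_(m <oo) ((Normc.normc (f (e m)) ^+ 2)%:E * mu [set e m]).
Proof. exact: (sqint_fibers f id). Qed.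

Lemma sqr_L2norm f : L2 mu f -> (L2norm mu f ^+ 2)%:E = sqint f.
Proof.
have s0 : 0 <= sqint f by apply: integral_ge0 => y _; exact: sqnorm_ge0.
move=> f2; rewrite /L2norm sqr_sqrtr ?fine_ge0// fineK// ge0_fin_numE//.
Qed.

Lemma sqint_indic (A : set X) (c : R) :
  sqint (fun y => Complex (c * \1_A y)%R 0%R) = (c ^+ 2)%:E * mu A.
Proof.
transitivity (\int[mu]_(y in A) (c ^+ 2)%:E).
  rewrite [RHS]integral_mkcond; apply: eq_integral => y _.
  rewrite /= expr0n/= addr0 sqrtr_sqr real_normK ?num_real// patchE indicE.
  by case: (y \in A); rewrite /= ?mulr1// mulr0 expr0n.
by rewrite integral_cst.
Qed.

Lemma Rintegral_point z (F : X -> R) : mu [set z] \is a fin_num ->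
  (forall y, y <> z -> F y = 0%R) ->
  Rintegral mu setT F = (F z * fine (mu [set z]))%R.
Proof.
move=> zfin Fz; rewrite /Rintegral.
have -> : \int[mu]_y (F y)%:E = \int[mu]_(y in [set z]) (F y)%:E.
  rewrite [RHS]integral_mkcond; apply: eq_integral => y _; rewrite patchE.
  have [/set_mem//|/negP yz] := boolP (y \in [set z]).
  by rewrite (Fz y)// => yz'; apply: yz; rewrite yz' inE.
rewrite (integral_cst_on (c := (F z)%:E)) => [|y ->//].
by rewrite fineM.
Qed.

Lemma app_iter n f : iter n (app (composition_operator mu phi)) f = f \o iter n phi.
Proof. by elim: n => //= n ->; apply/funext => y /=; rewrite -iterSr. Qed.

Lemma dom_inftyP f :
  dom_infty (composition_operator mu phi) f <-> forall n, L2 mu (f \o iter n phi).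
Proof.
have iterSE n : (f \o iter n phi) \o phi = f \o iter n.+1 phi.
  by apply/funext => y /=; rewrite -iterSr.
split=> [h [|n]|h n _].
- exact: (h 0%N I).
- by have [_ [_]] := h n.+1 I; rewrite app_iter /= iterSE.
elim: n => [|n ih]; first exact: (h 0%N).
by split => //; split; rewrite app_iter//= iterSE; exact: (h n.+1).
Qed.

Section generates.
Variables (w : nat -> R) (P : nat -> borel_measure R).
Hypotheses (w0 : forall m, (0 < w m)%R)
  (mu_w : forall m, mu [set e m] = (w m)%:E).
Hypotheses (P_neg : forall m, P m `]-oo, 0%R[%classic = 0)
  (P_moments : forall m, has_moments (P m))
  (P_h : forall m n, h_iter mu phi n (e m) = moment (P m) n).

Let mu_fiber m n :
  mu (iter n phi @^-1` [set e m]) = (w m)%:E * moment (P m) n.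
Proof.
rewrite -P_h /h_iter mu_w inver gt_eqF// muleCA -EFinM mulfV ?gt_eqF// mule1.
by [].
Qed.

Let mu_fiber_fin m n : mu (iter n phi @^-1` [set e m]) < +oo.
Proof.
rewrite mu_fiber lte_mul_pinfty ?lee_fin ?(ltW (w0 m))// moment_abs//.
exact: P_moments.
Qed.

(** Finitely supported functions lie in the domain of every power, as all the
    fibers have finite measure. *)
Let truncate N f (y : X) : C :=
  if `[< exists2 k, (k < N)%N & e k = y >] then f y else 0%R.

Let truncate_e N f k : truncate N f (e k) = if (k < N)%N then f (e k) else 0%R.
Proof.
rewrite /truncate; case: asboolP => [[i iN /e_inj <-]|]; first by rewrite iN.
by case: ifP => // kN []; exists k.
Qed.

Let truncate_dom N f : dom_infty (composition_operator mu phi) (truncate N f).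
Proof.
apply/dom_inftyP => n; rewrite /L2/= sqint_fibers.
rewrite (nneseries_split 0 N); last by move=> k _; rewrite mule_ge0 ?sqnorm_ge0.
rewrite [X in _ + X]eseries0 ?adde0; last first.
  move=> k; rewrite add0n => Nk _; rewrite truncate_e ltnNge Nk /=.
  by rewrite expr0n/= addr0 sqrtr0 expr0n mul0e.
rewrite add0n; apply: lte_sum_pinfty => k _.
by rewrite lte_mul_pinfty// ?sqnorm_ge0.
Qed.

Let dom_infty_dense : L2dense mu (dom_infty (composition_operator mu phi)).
Proof.
move=> f f2 eps eps0.
have f2' : \sum_(m <oo) ((Normc.normc (f (e m)) ^+ 2)%:E * mu [set e m]) < +oo.
  by rewrite -sqint_sum.
have [||N hN] := @nneseries_tail_small _ _ (eps ^+ 2 / 2)%R _ f2'.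
- by move=> k; rewrite mule_ge0 ?sqnorm_ge0.
- by rewrite divr_gt0// exprn_gt0.
exists (truncate N f); first exact: truncate_dom.
have hE : sqint (fun y => f y - truncate N f y)%R =
    \sum_(N <= m <oo) ((Normc.normc (f (e m)) ^+ 2)%:E * mu [set e m]).
  rewrite sqint_sum (nneseries_split 0 N); last first.
    by move=> k _; rewrite mule_ge0// lee_fin sqr_ge0.
  rewrite add0n big_nat big1 ?add0e => [|k /andP[_ kN]]; last first.
    by rewrite truncate_e kN subrr Normc.normc0 expr0n mul0e.
  rewrite eseries_cond [RHS]eseries_cond; apply: eq_eseriesr => k /= Nk.
  by rewrite truncate_e ltnNge Nk subr0.
have hlt : sqint (fun y => f y - truncate N f y)%R <= (eps ^+ 2 / 2)%:E.
  by rewrite hE; exact: hN.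
have h0 : 0 <= sqint (fun y => f y - truncate N f y)%R.
  by apply: integral_ge0 => y _; rewrite lee_fin sqr_ge0.
rewrite /L2norm; set s := (\int[mu]_y _) in hlt h0 *.
have sfin : s \is a fin_num by rewrite ge0_fin_numE// (le_lt_trans hlt)// ltry.
rewrite -(@ltr_pXn2r _ 2)// ?nnegrE ?sqrtr_ge0 ?(ltW eps0)// sqr_sqrtr ?fine_ge0//.
rewrite -lte_fin fineK// (le_lt_trans hlt)// lte_fin.
by have := exprn_gt0 2 eps0; lra.
Qed.

(** $\|C_\phi^n f\|^2$ is the sum of $|f(x)|^2\mu(x)h_{\phi^n}(x)$ over $x$, so
    it is represented by the corresponding mixture of the measures [P]. *)
Lemma generates_stieltjes_of_fibers :
  generates_stieltjes (composition_operator mu phi).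
Proof.
split; first exact: dom_infty_dense.
move=> f /dom_inftyP fdom.
pose c m : R := (Normc.normc (f (e m)) ^+ 2 * w m)%R.
have c0 m : (0 <= c m)%R by rewrite mulr_ge0 ?sqr_ge0// ltW.
pose N : borel_measure R := mseries (fun m => mscale (NngNum (c0 m)) (P m)) 0.
have N_neg : N `]-oo, 0%R[%classic = 0.
  rewrite /N /= /mseries eseries0// => m _ _.
  by transitivity ((c m)%:E * P m `]-oo, 0%R[%classic); [|rewrite P_neg mule0].
have NE n : moment N n = sqint (f \o iter n phi).
  rewrite moment_abs// /N ge0_integral_measure_series//; last exact: measurable_abs_expr.
  rewrite sqint_fibers; apply: eq_eseriesr => m _.
  rewrite ge0_integral_mscale//; last exact: measurable_abs_expr.
  by rewrite -moment_abs// mu_fiber muleA -EFinM.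
exists N; split; last exact: closed_support_ge0.
split; first by apply: has_moments_neg => // n; rewrite NE; exact: fdom.
by move=> n; rewrite NE app_iter sqr_L2norm.
Qed.

End generates.

(** Testing hyponormality on the indicator function of [z], whose image under
    the adjoint is a multiple of the indicator function of [phi z]. *)
Lemma hyponormal_fiber z (p q r : R) : (0 < q)%R ->
  mu [set z] = p%:E -> mu [set phi z] = q%:E -> mu (phi @^-1` [set z]) = r%:E ->
  hyponormal (composition_operator mu phi) -> (p ^+ 2 <= q * r)%R.
Proof.
move=> q0 muz muq mur [_ _ hyp].
pose f y : C := Complex (1 * \1_[set z] y)%R 0%R.
pose h y : C := Complex (p / q * \1_[set phi z] y)%R 0%R.
have f2 : sqint f = p%:E by rewrite sqint_indic expr1n mul1e.
have fphi2 : sqint (f \o phi) = r%:E.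
  by rewrite -mur -[RHS]mul1e -(expr1n _ 2) -sqint_indic.
have h2 : sqint h = ((p / q) ^+ 2 * q)%:E by rewrite sqint_indic muq EFinM.
have df : dom (composition_operator mu phi) f.
  by split; rewrite /L2/= ?f2 ?fphi2 ltry.
have f_z : f z = Complex 1%R 0%R by rewrite /f indicE mem_set// mulr1.
have h_z : h (phi z) = Complex (p / q)%R 0%R by rewrite /h indicE mem_set// mulr1.
have f_nz y : y <> z -> f y = 0%R by move=> yz; rewrite /f indicE memNset// mulr0.
have h_nz y : y <> phi z -> h y = 0%R by move=> yz; rewrite /h indicE memNset// mulr0.
have adj : adjoint_graph (composition_operator mu phi) f h.
  split; rewrite /L2/= ?f2 ?h2 ?ltry// => g _.
  rewrite /L2inner; congr Complex.
  - rewrite (@Rintegral_point z) ?muz// => [|y yz]; last first.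
      by rewrite f_nz// conjc0 mulr0.
    rewrite (@Rintegral_point (phi z)) ?muq// => [|y yz]; last first.
      by rewrite h_nz// conjc0 mulr0.
    rewrite f_z h_z /=; case: (g (phi z)) => u v /=.
    by field; rewrite gt_eqF.
  - rewrite (@Rintegral_point z) ?muz// => [|y yz]; last first.
      by rewrite f_nz// conjc0 mulr0.
    rewrite (@Rintegral_point (phi z)) ?muq// => [|y yz]; last first.
      by rewrite h_nz// conjc0 mulr0.
    rewrite f_z h_z /=; case: (g (phi z)) => u v /=.
    by field; rewrite gt_eqF.
have := hyp f h df adj.
rewrite -(@ler_pXn2r _ 2)// ?nnegrE ?sqrtr_ge0// -lee_fin !sqr_L2norm; last 2 first.
- by case: df.
- by case: adj.
rewrite h2 fphi2 lee_fin => le.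
have -> : (p ^+ 2 = q * ((p / q) ^+ 2 * q))%R by field; rewrite gt_eqF.
by rewrite ler_pM2l.
Qed.

End countable.

(** * The measures representing the Radon-Nikodym derivatives *)

Section weights.
Context {R : realType} (b : R).
Hypothesis b8 : (8 <= b)%R.
Let b2 : (2 <= b)%R. Proof. by have := b8; lra. Qed.
Let b_gt0 : (0 < b)%R. Proof. exact: lt_le_trans b2. Qed.
Let b_ge0 : (0 <= b)%R. Proof. exact: ltW. Qed.

(** The moments of the odd half of the lattice measure divided by $t-1$; taking
    first differences gives back those of the odd half ([loop_sumS]). *)
Definition loop_sum n : \bar R :=
  \sum_(k <oo) (critical b k / (b ^+ k.*2.+1 - 1) * (b ^+ k.*2.+1) ^+ n)%:E.

Lemma loop_factor k : (7 <= b ^+ k.*2.+1 - 1)%R.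
Proof. by have := expr_b_ge b2 (isT : (1 <= k.*2.+1)%N); rewrite expr1; have := b8; lra. Qed.

Let loop_ge0 k n : (0 <= critical b k / (b ^+ k.*2.+1 - 1) * (b ^+ k.*2.+1) ^+ n)%R.
Proof.
rewrite mulr_ge0 ?exprn_ge0// divr_ge0 ?(ltW (critical_gt0 b2 k))//.
by have := loop_factor k; lra.
Qed.

Lemma loop_sumS n : loop_sum n.+1 = loop_sum n + odd_sum b n.+1.
Proof.
rewrite odd_sum_critical// -nneseriesD; last 2 first.
- by move=> k _ _; rewrite lee_fin.
- by move=> k _ _; rewrite lee_fin mulr_ge0 ?exprn_ge0// ltW// critical_gt0.
apply: eq_eseriesr => k _; rewrite -EFinD; congr EFin.
have := loop_factor k; set x := (b ^+ _)%R => x7; rewrite exprS; field.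
by rewrite gt_eqF//; lra.
Qed.

Lemma loop_sum_ge0 n : 0 <= loop_sum n.
Proof. by apply: nneseries_ge0 => k _ _; rewrite lee_fin. Qed.

Lemma loop_sum0_le : loop_sum 0 <= (2^-1)%:E.
Proof.
have -> : (2^-1 = 2 * 4^-1 :> R)%R by field.
apply: nneseries_fin_half => // k; first by rewrite lee_fin.
rewrite lee_fin expr0 mulr1 ler_pdivrMr; last by have := loop_factor k; lra.
have t := loop_factor k; have d := qfact_ge b2 k.
have d0 := qfact_gt0 b2 k.*2; have p0 : (0 < 2 ^+ k :> R)%R by rewrite exprn_gt0.
rewrite /critical qfactS -/(qfact b _).
set y := (b ^+ _)%R in t *; set q := qfact _ _ in d d0 *; set p := (2 ^+ k)%R in d p0 *.
rewrite ler_pdivrMr ?mulr_gt0//; last by lra.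
have -> : (4^-1 / p * (y - 1) * (q * (y - 1)) = q / p * ((y - 1) ^+ 2 / 4))%R.
  by field; rewrite gt_eqF.
have qp : (1 <= q / p)%R by rewrite ler_pdivlMr// mul1r.
have y2 : (y <= (y - 1) ^+ 2 / 4)%R by rewrite expr2; nra.
by rewrite (le_trans y2)// ler_peMl//; lra.
Qed.

Lemma loop_sum_fin n : loop_sum n < +oo.
Proof.
elim: n => [|n ih]; first exact: le_lt_trans loop_sum0_le (ltry _).
by rewrite loop_sumS lte_add_pinfty//; have [] := even_odd_fin b2 n.+1.
Qed.

Lemma loop_sum0_gt0 : 0 < loop_sum 0.
Proof.
rewrite /loop_sum nneseries_recl0 => [|k]; last by rewrite lee_fin.
apply: lt_le_trans (leeDl _ _); last by apply: nneseries_ge0 => k _ _; rewrite lee_fin.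
rewrite lte_fin expr0 mulr1 divr_gt0 ?critical_gt0//.
by have := loop_factor 0; lra.
Qed.

(** What remains of [even_sum] after the first [r] atoms have been given to the
    other branches. *)
Definition branch_sum r n : \bar R :=
  \sum_(k <oo) (b ^+ ((r + k).*2 * n) / qfact b (r + k).*2)%:E.

Lemma even_sum_branch r n : even_sum b n =
  (\sum_(i < r) (b ^+ (i.*2 * n) / qfact b i.*2))%:E + branch_sum r n.
Proof.
have e0 k i : 0 <= (b ^+ k / qfact b i)%:E by rewrite lee_fin qterm_ge0.
rewrite /even_sum (nneseries_split 0 r)// add0n big_mkord sumEFin; congr (_ + _).
by rewrite -(nneseries_addn r)//; apply: eq_eseriesr => k _; rewrite addnC.
Qed.

Lemma branch_sum_fin r n : branch_sum r n < +oo.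
Proof.
have [+ _] := even_odd_fin b2 n; rewrite (even_sum_branch r); apply: le_lt_trans.
by rewrite leeDr// lee_fin sumr_ge0// => i _; rewrite qterm_ge0.
Qed.

Lemma branch_sum_gt0 r n : 0 < branch_sum r n.
Proof.
rewrite /branch_sum nneseries_recl0 => [|k]; last by rewrite lee_fin qterm_ge0.
apply: lt_le_trans (leeDl _ _); last first.
  by apply: nneseries_ge0 => k _ _; rewrite lee_fin qterm_ge0.
by rewrite lte_fin divr_gt0 ?exprn_gt0// qfact_gt0.
Qed.

Definition loop_measure (c : R) : borel_measure R :=
  atoms ((fun k => b ^+ k.*2.+1)%R : nat -> measurableTypeR R)
    (fun k => c * critical b k / (b ^+ k.*2.+1 - 1))%R.

Definition branch_measure r (c : R) j : borel_measure R :=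
  atoms ((fun k => b ^+ (r + k).*2)%R : nat -> measurableTypeR R)
    (fun k => c * (b ^+ ((r + k).*2 * j) / qfact b (r + k).*2))%R.

Let expb_ge0 n : (0 <= b ^+ n)%R. Proof. exact: exprn_ge0. Qed.

Let loop_weight_ge0 c k : (0 <= c)%R -> (0 <= c * critical b k / (b ^+ k.*2.+1 - 1))%R.
Proof.
move=> c0; rewrite divr_ge0//; first by rewrite mulr_ge0// ltW// critical_gt0.
by have := loop_factor k; lra.
Qed.

Let branch_weight_ge0 r c j k : (0 <= c)%R ->
  (0 <= c * (b ^+ ((r + k).*2 * j) / qfact b (r + k).*2))%R.
Proof. by move=> c0; rewrite mulr_ge0 ?qterm_ge0. Qed.

Lemma moment_loop c n : (0 <= c)%R ->
  moment (loop_measure c) n = c%:E * loop_sum n.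
Proof.
move=> c0; rewrite moment_atoms// => [|k]; last exact: loop_weight_ge0.
rewrite /loop_sum -nneseriesZl => [|k _]; last by rewrite lee_fin.
by apply: eq_eseriesr => k _; rewrite -EFinM !mulrA.
Qed.

Lemma moment_branch r c j n : (0 <= c)%R ->
  moment (branch_measure r c j) n = c%:E * branch_sum r (j + n).
Proof.
move=> c0; rewrite moment_atoms// => [|k]; last exact: branch_weight_ge0.
rewrite /branch_sum -nneseriesZl => [|k _]; last by rewrite lee_fin qterm_ge0.
by apply: eq_eseriesr => k _; rewrite -EFinM mulnDr exprD
  [(b ^+ (_ * n))%R]exprM; congr EFin; ring.
Qed.

Lemma loop_measure_neg c : (0 <= c)%R -> loop_measure c `]-oo, 0%R[%classic = 0.
Proof. by move=> c0; apply: atoms_neg => // k; exact: loop_weight_ge0. Qed.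

Lemma branch_measure_neg r c j : (0 <= c)%R ->
  branch_measure r c j `]-oo, 0%R[%classic = 0.
Proof. by move=> c0; apply: atoms_neg => // k; exact: branch_weight_ge0. Qed.

Lemma loop_index c : (0 < c)%R ->
  H_determinate_with_index (moment (loop_measure c)) 0%R 0.
Proof.
move=> c0; apply: (@atoms_index _ _ _ _ _ 0) => // [k|k]; first exact/loop_weight_ge0/ltW.
by rewrite leqn0 -(rwP eqP) loop_determinate//; split; lia.
Qed.

Lemma branch_index r c j : (0 < c)%R -> (0 < r)%N -> (j < r.*2)%N ->
  H_determinate_with_index (moment (branch_measure r c j)) 0%R
    (((r.*2.-1 - j)./2)%:R)%:E.
Proof.
move=> c0 r0 jr; apply: atoms_index => // [k|k]; first exact/branch_weight_ge0/ltW.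
have -> : (fun i => c * (b ^+ ((r + i).*2 * j) / qfact b (r + i).*2) *
                    (b ^+ (r + i).*2) ^+ (2 * k))%R =
    (fun i => c * (b ^+ ((r + i).*2 * (j + 2 * k)) / qfact b (r + i).*2))%R.
  by apply/funext => i; rewrite mulnDr exprD [(b ^+ (_ * (2 * k)))%R]exprM; ring.
by rewrite branch_determinate//; split; lia.
Qed.

End weights.

(** * Discrete measures on branches attached to a loop *)

Section circuit.
Context (R : realType) (eta : nat) (d : measure_display) (X : measurableType d).
Hypotheses (eta0 : (0 < eta)%N) (hmeas : forall A : set X, measurable A).
Variables (x0 : X) (x_ : nat -> nat -> X) (phi : X -> X).
Hypotheses
  (hX : forall y : X, y = x0 \/
       exists i j : nat, [/\ (1 <= i <= eta)%N, (1 <= j)%N & y = x_ i j])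
  (hx0 : forall i j : nat, (1 <= i <= eta)%N -> (1 <= j)%N -> x_ i j <> x0)
  (hx : forall i j i' j' : nat, (1 <= i <= eta)%N -> (1 <= j)%N ->
       (1 <= i' <= eta)%N -> (1 <= j')%N ->
       x_ i j = x_ i' j' -> i = i' /\ j = j')
  (hphi0 : phi x0 = x0)
  (hphi1 : forall i : nat, (1 <= i <= eta)%N -> phi (x_ i 1%N) = x0)
  (hphi2 : forall i j : nat, (1 <= i <= eta)%N -> (2 <= j)%N ->
       phi (x_ i j) = x_ i (j - 1)%N).

Definition vertex n : X :=
  if n is m.+1 then x_ (m %% eta).+1 (m %/ eta).+1 else x0.

Lemma vertexE i j : (i < eta)%N -> vertex (j * eta + i).+1 = x_ i.+1 j.+1.
Proof. by move=> ie; rewrite /= modnMDl divnMDl// modn_small// divn_small// addn0. Qed.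

Let mod_range m : (1 <= (m %% eta).+1 <= eta)%N.
Proof. by rewrite /= ltn_mod. Qed.

Lemma vertex_inj : injective vertex.
Proof.
move=> [|m] [|n]//=.
- by move=> h; case: (@hx0 _ (n %/ eta).+1 (mod_range n) isT); rewrite -h.
- by move=> h; case: (@hx0 _ (m %/ eta).+1 (mod_range m) isT); rewrite h.
move=> h; have [[hm] [hd]] := hx (mod_range m) (ltn0Sn _) (mod_range n) (ltn0Sn _) h.
by rewrite (divn_eq m eta) (divn_eq n eta) hm hd.
Qed.

Lemma vertex_surj y : exists n, y = vertex n.
Proof.
have [->|[[|i] [[|j] []]]//] := hX y; first by exists 0%N.
by move=> ie _ ->; exists (j * eta + i).+1; rewrite vertexE.
Qed.

Lemma phi_surj y : exists z, phi z = y.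
Proof.
have [->|[i [j [ie j1 ->]]]] := hX y; first by exists x0.
by exists (x_ i j.+1); rewrite hphi2// subn1.
Qed.

Lemma fiber_vertex i j n : (1 <= i <= eta)%N -> (1 <= j)%N ->
  iter n phi @^-1` [set x_ i j] = [set x_ i (j + n)%N].
Proof.
move=> ie; elim: n j => [|n ih] j j1; first by rewrite addn0.
have fib k : (1 <= k)%N -> phi @^-1` [set x_ i k] = [set x_ i k.+1].
  move=> k1; apply/seteqP; split => y /=; last by move=> ->; rewrite hphi2// subn1.
  have [->|[i' [[|[|j']] [ie' // _ ->]]]] := hX y.
  - by rewrite hphi0 => /esym; move/hx0; case.
  - by rewrite hphi1// => /esym; move/hx0; case.
  - by rewrite hphi2// subn1 => /hx[]// -> /= ->.
rewrite addnS -fib; last by rewrite (leq_trans j1)// leq_addr.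
by rewrite -ih//; apply/seteqP; split => y /=; rewrite -iterSr.
Qed.

(** A point first reaches [x0] at time [n.+1] exactly when it lies at height
    [n.+1] on a branch. *)
Lemma fiber_root n : iter n.+1 phi @^-1` [set x0] =
  iter n phi @^-1` [set x0] `|` \big[setU/set0]_(i < eta) [set x_ i.+1 n.+1].
Proof.
rewrite -(bigcup_mkord eta (fun i => [set x_ i.+1 n.+1])).
have -> : \bigcup_(i in `I_eta) [set x_ i.+1 n.+1] =
    \bigcup_(i in `I_eta) (iter n phi @^-1` [set x_ i.+1 1%N]).
  by apply: eq_bigcupr => i /= ie; rewrite fiber_vertex// add1n.
apply/seteqP; split => y /=.
- move=> h; have [->|[[|i] [[|[|j]] [ie // _ yE]]]] := hX (iter n phi y); first by left.
  + by right; exists i.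
  + by move: h; rewrite yE hphi2// subn1 => /hx0; case.
- by move=> [->//|[i /= ie ->]]; rewrite hphi1.
Qed.

Section masses.
Variable mass : nat -> nat -> R.
Hypothesis mass_gt0 : forall i j, (0 < mass i j)%R.

Definition vertex_mass n : R :=
  if n is m.+1 then mass (m %% eta) (m %/ eta).+1 else 1%R.

Lemma vertex_mass_gt0 n : (0 < vertex_mass n)%R.
Proof. by case: n => /=. Qed.

Definition circuit_measure : {measure set X -> \bar R} := atoms vertex vertex_mass.
Local Notation mu := circuit_measure.

Lemma circuit_measure_vertex n : mu [set vertex n] = (vertex_mass n)%:E.
Proof.
apply: atoms_set1 => //; first exact: vertex_inj.
by move=> k; rewrite ltW// vertex_mass_gt0.
Qed.

Lemma circuit_measure_branch i j : (i < eta)%N ->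
  mu [set x_ i.+1 j.+1] = (mass i j.+1)%:E.
Proof.
move=> ie; rewrite -vertexE// circuit_measure_vertex /=.
by rewrite modnMDl divnMDl// modn_small// divn_small// addn0.
Qed.

Lemma circuit_measure_discrete : discrete_measure mu.
Proof.
split => //.
- exists (fun n => [set vertex n]).
    by apply/seteqP; split => // y _; have [n ->] := vertex_surj y; exists n.
  by move=> n; split => //; rewrite circuit_measure_vertex ltry.
- move=> y; have [n ->] := vertex_surj y.
  by rewrite circuit_measure_vertex lte_fin vertex_mass_gt0.
Qed.

Lemma circuit_measure_fiber_root n :
  mu (iter n.+1 phi @^-1` [set x0]) =
  mu (iter n phi @^-1` [set x0]) + (\sum_(i < eta) mass i n.+1)%:E.
Proof.
rewrite fiber_root measureU//; last first.
  apply/seteqP; split => // y [/= yx0].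
  rewrite -(bigcup_mkord eta (fun i => [set x_ i.+1 n.+1])) => -[i /= ie yE].
  have : (iter n phi @^-1` [set x_ i.+1 1%N]) y by rewrite fiber_vertex// add1n.
  by rewrite /= yx0 => /esym; exact: hx0.
congr (_ + _); rewrite measure_bigsetU_ord//; last first.
  apply/trivIsetP => i j _ _ ij; apply/seteqP; split => // y [/= -> h].
  have [[ijE] _] := @hx i.+1 n.+1 j.+1 n.+1 (ltn_ord i) isT (ltn_ord j) isT h.
  by move/eqP: ij; apply; exact: val_inj.
by rewrite -sumEFin; apply: eq_bigr => i _; exact: circuit_measure_branch.
Qed.

End masses.
End circuit.

Theorem theorem5p5p2 (R : realType) (eta : nat) (heta : (2 <= eta)%N)
    (d : measure_display) (X : measurableType d)
    (hmeas : forall A : set X, measurable A)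
    (x0 : X) (x_ : nat -> nat -> X)
    (hX : forall y : X, y = x0 \/
       exists i j : nat, [/\ (1 <= i <= eta)%N, (1 <= j)%N & y = x_ i j])
    (hx0 : forall i j : nat, (1 <= i <= eta)%N -> (1 <= j)%N -> x_ i j <> x0)
    (hx : forall i j i' j' : nat, (1 <= i <= eta)%N -> (1 <= j)%N ->
       (1 <= i' <= eta)%N -> (1 <= j')%N ->
       x_ i j = x_ i' j' -> i = i' /\ j = j')
    (phi : X -> X)
    (hphi0 : phi x0 = x0)
    (hphi1 : forall i : nat, (1 <= i <= eta)%N -> phi (x_ i 1%N) = x0)
    (hphi2 : forall i j : nat, (1 <= i <= eta)%N -> (2 <= j)%N ->
       phi (x_ i j) = x_ i (j - 1)%N) :
  exists mu : {measure set X -> \bar R},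
    discrete_measure mu /\
    let C_phi := composition_operator mu phi in
    let h := h_iter mu phi in
    (* (i) *)
    (op_injective C_phi /\ generates_stieltjes C_phi) /\
    (* (ii) *)
    ~ hyponormal C_phi /\
    (* (iii) *)
    (forall x : X, stieltjes_moment_sequence (fun n => h n x)) /\
    (* (iv) *)
    H_determinate_with_index (fun n => h n x0) 0%R 0 /\
    (* (v) *)
    (forall i j : nat, (1 <= i <= eta - 1)%N -> (1 <= j)%N ->
       H_determinate_infinite_index (fun n => h n (x_ i j))) /\
    (* (vi) *)
    (forall j : nat, (1 <= j <= 2 * eta - 4)%N ->
       H_determinate (fun n => h n (x_ eta j)) /\
       forall P : borel_measure R,
         H_representing P (fun n => h n (x_ eta j)) ->
         (eta%:R - 2 - (uphalf j)%:R)%:E <= ind 0%R P /\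
         ind 0%R P <= (eta%:R - 2 - (j./2)%:R)%:E).
Proof.
pose b : R := 8%:R; have b8 : (8 <= b)%R by rewrite lexx.
have b2 : (2 <= b)%R by lra.
have eb_gt0 n : (0 < b ^+ n)%R by rewrite exprn_gt0.
have eta0 : (0 < eta)%N by exact: ltnW.
pose r := eta.-1; have r0 : (0 < r)%N by rewrite /r -ltnS prednK.
have etaE : eta = r.+1 by rewrite /r prednK.
pose S := fine (loop_sum b 0).
have S_ub := loop_sum0_le b8; have S_lb := loop_sum0_gt0 b8.
have SE : loop_sum b 0 = S%:E.
  by rewrite fineK// ge0_fin_numE ?(ltW S_lb)// (le_lt_trans S_ub)// ltry.
rewrite SE lee_fin in S_ub; rewrite SE lte_fin in S_lb.
(* With this constant the measure representing the sequence at x0 has mass 1. *)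
pose A := (S^-1)%R.
have A_ge2 : (2 <= A)%R by rewrite -[leLHS]invrK lef_pV2 ?posrE ?invr_gt0.
have A_gt0 : (0 < A)%R by lra.
pose mass i j : R :=
  if (i < r)%N then (A * (b ^+ (i.*2 * j) / qfact b i.*2))%R
  else (A * fine (branch_sum b r j))%R.
have branchE j : branch_sum b r j = (fine (branch_sum b r j))%:E.
  by rewrite fineK// ge0_fin_numE ?branch_sum_fin// ltW// branch_sum_gt0.
have branch_gt0 j : (0 < fine (branch_sum b r j))%R.
  by rewrite -lte_fin -branchE branch_sum_gt0.
have mass_gt0 i j : (0 < mass i j)%R.
  by rewrite /mass; case: ifP => _; rewrite mulr_gt0// divr_gt0// qfact_gt0.
have mass_sum j : (\sum_(i < eta) mass i j)%:E = A%:E * even_sum b j.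
  rewrite (even_sum_branch b8 r) branchE -EFinD -EFinM etaE big_ord_recr/=.
  rewrite mulrDr mulr_sumr {2}/mass ltnn; congr (_ + _)%:E.
  by apply: eq_bigr => i _; rewrite /mass ltn_ord.
pose mu := circuit_measure eta x0 x_ mass.
have mu_x0 : mu [set x0] = 1.
  exact: (circuit_measure_vertex eta0 hmeas hx0 hx mass_gt0 0).
(* The increments are moments of the even half; traded for those of the odd
   half, they are the increments of [loop_sum]. *)
have mu_root n : mu (iter n phi @^-1` [set x0]) = A%:E * loop_sum b n.
  elim: n => [|n ih].
    by rewrite SE -EFinM mulVf ?gt_eqF//; exact: mu_x0.
  rewrite (circuit_measure_fiber_root eta0 hmeas hX hx0 hx)// ih mass_sum.
  by rewrite loop_sumS// even_odd_sum// ge0_muleDr// ?loop_sum_ge0 ?odd_sum_ge0.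
have mu_branch i j : (i < eta)%N -> (1 <= j)%N ->
    mu [set x_ i.+1 j] = (mass i j)%:E.
  by case: j => // j ie _; rewrite (circuit_measure_branch eta0 hmeas hx0 hx mass_gt0).
pose Q i j : borel_measure R := if (i < r)%N then point_mass (b ^+ i.*2)
  else branch_measure b r (fine (branch_sum b r j))^-1 j.
have root_h n : h_iter mu phi n x0 = moment (loop_measure b A) n.
  rewrite moment_loop ?(ltW A_gt0)// -mu_root /h_iter.
  by rewrite mu_x0 inve1 mule1.
have branch_h i j n : (i < eta)%N -> (1 <= j)%N ->
    h_iter mu phi n (x_ i.+1 j) = moment (Q i j) n.
  move=> ie j1; rewrite /h_iter (fiber_vertex hX hx0 hx hphi0 hphi1 hphi2)//.
  rewrite !mu_branch// ?addn_gt0 ?j1// inver gt_eqF// -EFinM /mass /Q.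
  case: ifP => _.
    rewrite moment_point_mass// mulnDr exprD [(b ^+ (_ * n))%R]exprM; congr EFin.
    field; rewrite !gt_eqF ?qfact_gt0//.
  rewrite moment_branch ?invr_ge0 ?(ltW (branch_gt0 j))// [branch_sum _ _ (_ + _)]branchE -EFinM.
  congr EFin; field; rewrite !gt_eqF//.
pose P m := if m is k.+1 then Q (k %% eta)%N (k %/ eta).+1 else loop_measure b A.
have P_h m n : h_iter mu phi n (vertex eta x0 x_ m) = moment (P m) n.
  case: m => [|m]; first exact: root_h.
  by rewrite /vertex branch_h// ltn_mod.
have P_neg m : P m `]-oo, 0%R[%classic = 0.
  case: m => [|m]; first by rewrite loop_measure_neg// ltW.
  rewrite /P /Q; case: ifP => _; last by rewrite branch_measure_neg// invr_ge0 ltW.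
  by apply: atoms_neg => // k; rewrite mulr_ge0 ?exprn_ge0.
have P_moments m : has_moments (P m).
  apply: has_moments_neg => // n; case: m => [|m].
    by rewrite moment_loop ?(ltW A_gt0)// lte_mul_pinfty ?loop_sum_fin// lee_fin ltW.
  rewrite /P /Q; case: ifP => _; first by rewrite moment_point_mass// ltry.
  rewrite moment_branch ?invr_ge0 ?(ltW (branch_gt0 _))//.
  by rewrite [branch_sum _ _ (_ + _)]branchE -EFinM ltry.
exists mu; split; first exact: circuit_measure_discrete.
split.
  split.
    move=> f g _ _ fg; apply/funext => y.
    have [z <-] := phi_surj hX hphi0 hphi2 y.
    exact: (congr1 (fun h => h z) fg).
  apply: (generates_stieltjes_of_fibers hmeas (vertex_inj eta0 hx0 hx)
    (vertex_surj eta0 hX) (vertex_mass_gt0 eta mass_gt0) _ P_neg P_moments P_h).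
  exact: circuit_measure_vertex.
split.
  (* The first branch carries the atom at 1, so all its vertices have mass A. *)
  move=> hyp; have mass0 k : mass 0%N k = A.
    by rewrite /mass r0 double0 mul0n expr0 qfact0 divr1 mulr1.
  have mu_z : mu [set x_ 1%N 1%N] = A%:E by rewrite mu_branch// mass0.
  have mu_phi_z : mu [set phi (x_ 1%N 1%N)] = 1%R%:E by rewrite hphi1.
  have mu_fiber : mu (phi @^-1` [set x_ 1%N 1%N]) = A%:E.
    transitivity (mu (iter 1 phi @^-1` [set x_ 1%N 1%N])) => //.
    by rewrite (fiber_vertex hX hx0 hx hphi0 hphi1 hphi2)// mu_branch// mass0.
  have := hyponormal_fiber hmeas ltr01 mu_z mu_phi_z mu_fiber hyp.
  by rewrite expr2; nra.
split.
  move=> y; have [m ->] := vertex_surj eta0 hX y.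
  exists (P m); split; last exact: closed_support_ge0.
  by split.
split.
  have -> : (fun n => h_iter mu phi n x0) = moment (loop_measure b A).
    exact/funext.
  exact: loop_index.
split.
  move=> [|i] j // /andP[_ ie] j1.
  have ir : (i < r)%N by rewrite /r -subn1.
  have -> : (fun n => h_iter mu phi n (x_ i.+1 j)) = moment (point_mass (b ^+ i.*2)).
    apply/funext => n; rewrite branch_h//; last by rewrite etaE ltnS ltnW.
    by rewrite /Q ir.
  exact: point_mass_infinite_index.
move=> j /andP[j1 je].
have [K KE] : exists K, eta = (K + 2 + j./2)%N by exists (eta - 2 - j./2)%N; lia.
have := @branch_index _ b b8 r (fine (branch_sum b r j))^-1%R j.
rewrite invr_gt0 => /(_ (branch_gt0 j) r0) idx.
have {idx}[|hdet hind] := idx; first by lia.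
have -> : (fun n => h_iter mu phi n (x_ eta j)) =
    moment (branch_measure b r (fine (branch_sum b r j))^-1 j).
  by apply/funext => n; rewrite etaE branch_h ?etaE// /Q ltnn.
split => // rho /hind ->.
have -> : ((r.*2.-1 - j)./2 = K)%N by lia.
have etaR : (eta%:R = K%:R + 2 + (j./2)%:R :> R)%R by rewrite KE !natrD.
have half_le : ((j./2)%:R <= (uphalf j)%:R :> R)%R by rewrite ler_nat; lia.
by rewrite !lee_fin etaR; split; lra.
Qed.
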